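(* (1) Let $\mathcal{V}$ be a frame and $X$ a $\mathcal{V}$-graph. For each $r\in\mathcal{V}$ and each $n\in\mathbb{N}$, the $n$-simplices of $N_{\max}(X)(r)$ correspond exactly to the $(n+1)$-tuples $(x_0,\dots,x_n)$ of vertices of $X$ such that $X(x_i,x_j)\le r$ for each $0\le i\le j\le n$. (2) If $\mathcal{V}=\mathbb{R}$, then $N_{\max}$ yields the Vietoris-Rips complex in the following distinct yet related senses: (a) There is a (non-functorial) assignment to each honest metric space $X$ of an $\ell^1$ metric space $X'$ such that for each $r\in\mathbb{R}$ the geometric realization of $\operatorname{VR}(X)(r)$ is (homeomorphic to) the geometric realization of $N_{\max}(X')(r)$. (b) The composite functors $\mathbf{Met}\hookrightarrow \mathbb{R}\text{-}\mathbf{Gph}\xrightarrow{N_{\max}}\operatorname{sPSh}(\mathbb{R})$ and $\mathbf{Met}\xrightarrow{\operatorname{VR}}\mathbf{SCpx}^{\mathbb{R}^{\mathrm{op}}}\xrightarrow{\operatorname{Sing}}\operatorname{sPSh}(\mathbb{R})$ (where $\operatorname{Sing}$ is applied pointwise on $\mathbb{R}^{\mathrm{op}}$) coincide; moreover, for each $X\in\mathbf{Met}$ and each $r\in\mathbb{R}$, the geometric realization of $\operatorname{VR}(X)(r)$ is homotopy equivalent to the geometric realization of $\operatorname{Sing}(\operatorname{VR}(X))(r)$.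
   Context: A frame is a complete lattice $\mathcal{V}$ in which finite meets distribute over arbitrary joins. A poset is viewed as a category with one arrow $s\to r$ iff $s$ is below or equal to $r$ in the lattice order. Convention: for $r,s\in\mathcal{V}$ write $r\le s$ iff $s\to r$ in $\mathcal{V}$; thus $\le$ is the opposite of the lattice order, i.e. the order of $\mathcal{V}^{\mathrm{op}}$. The symbols $\inf,\sup,\min,\max$ are taken with respect to $\le$ (so $\max$ is the binary meet of $\mathcal{V}$). The least element for $\le$ (top of $\mathcal{V}$) is written $0$, the greatest for $\le$ is written $\infty$. The empty $\max$ is $0$. $\mathbb{R}$ denotes the frame of extended nonnegative reals $0\le r\le\infty$, with $s\to r$ iff $r\le s$ in the usual order; so the $\le$ of the convention is the usual order. A $\mathcal{V}$-graph $X$ is a set (also written $X$, of vertices) with an element $X(a,b)\in\mathcal{V}$ for each ordered pair of vertices, such that $X(a,a)=0$. A morphism $f:X\to Y$ is a function on vertices with $X(a,b)\ge Y(fa,fb)$ for all $a,b$. The category is $\mathcal{V}\text{-}\mathbf{Gph}$. An $\ell^1$ metric space is an $\mathbb{R}$-graph with $X(a,c)\le X(a,b)+X(b,c)$ for all $a,b,c$. It is symmetric if $X(a,b)=X(b,a)$ always, and strict if $X(a,b)=0$ implies $a=b$. An honest metric space is a strict symmetric $\ell^1$ metric space (a metric space in the classical sense). $\mathbf{Met}$ is the full subcategory of $\mathbb{R}\text{-}\mathbf{Gph}$ on honest metric spaces (morphisms are the $1$-Lipschitz maps). $\operatorname{sPSh}(\mathcal{V})$ is the category of functors from $\mathcal{V}^{\mathrm{op}}$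 (the poset with order $\le$) to simplicial sets. The nerve $N_{\max}:\mathcal{V}\text{-}\mathbf{Gph}\to\operatorname{sPSh}(\mathcal{V})$: $N_{\max}(X)(r)_n$ is the set of tuples $(x_0,\dots,x_n)$ of vertices of $X$ for which there exist $r_1,\dots,r_n\in\mathcal{V}$ with $\max_{1\le k\le n}r_k\le r$ and $X(x_i,x_j)\le\max_{i+1\le k\le j}r_k$ for all $0\le i\le j\le n$. The $i$-th face map omits the $i$-th vertex, the $i$-th degeneracy repeats it, $r\le s$ acts by inclusion, and morphisms of graphs act vertexwise. A simplicial complex consists of a vertex set $V$ and a downward closed set $S$ of nonempty finite subsets of $V$ containing all singletons; an $n$-simplex is an element of $S$ with $n+1$ elements. Morphisms are functions on vertices sending elements of $S$ to elements of $S$; the category is $\mathbf{SCpx}$. $\operatorname{Sing}:\mathbf{SCpx}\to\mathbf{sSet}$ is $\operatorname{Sing}(X)_n=\{(x_0,\dots,x_n)\in V_X^{n+1}\mid\{x_0,\dots,x_n\}\in S_X\}$, with faces and degeneracies given by omitting and repeating vertices. For an honest metric space $X$, $\operatorname{VR}(X)\in\mathbf{SCpx}^{\mathbb{R}^{\mathrm{op}}}$ is the functor for which $\operatorname{VR}(X)(r)$ has vertex set $X$ and has as $n$-simplices the sets of $n+1$ distinct points at pairwise distance $\le r$; morphisms $r\le s$ act as the identity on vertices. This gives a functor $\operatorname{VR}:\mathbf{Met}\to\mathbf{SCpx}^{\mathbb{R}^{\mathrm{op}}}$.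
   Formalization: In (2)(a) the homeomorphism is claimed only for r < ∞: at r = ∞ it fails, e.g. for two points at finite distance, where |VR(X)(∞)| is a closed interval but |N_max(X')(∞)| is empty, a point or a non-compact infinite CW complex. *)

(* Defs.v *)
From HB Require Import structures.
From mathcomp Require Import all_boot all_order all_algebra generic_quotient.
From mathcomp Require Import all_classical all_reals all_analysis.
From Stdlib Require Relation_Operators.

Set Implicit Arguments.
Unset Strict Implicit.
Unset Printing Implicit Defensive.

Import Order.TTheory GRing.Theory Num.Theory.
Import numFieldNormedType.Exports.

Local Open Scope classical_set_scope.
Local Open Scope ring_scope.

Local Open Scope quotient_scope.

Local Obligation Tactic := idtac.

HB.mixin Record TBLattice_isFrame d T of Order.TBLattice d T := {
  bigjoin : set T -> T;
  bigjoin_ub : forall (A : set T) x, A x -> (x <= bigjoin A)%O;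
  bigjoin_least : forall (A : set T) y,
    (forall x, A x -> (x <= y)%O) -> (bigjoin A <= y)%O;
  meet_bigjoin : forall x (A : set T),
    Order.meet x (bigjoin A) = bigjoin [set Order.meet x a | a in A]
}.

#[short(type="frameType")]
HB.structure Definition Frame d :=
  { T of TBLattice_isFrame d T & Order.TBLattice d T }.

(* The order of V^op.  For it the least element "0" is \top, the greatest
   element "oo" is \bot, and binary max is the meet of V. *)
Definition leop {d : Order.disp_t} {V : porderType d} (r s : V) : bool :=
  (s <= r)%O.

Notation "r ≼ s" := (leop r s) (at level 70, no associativity).

Definition nnereal (R : realType) : Type := {x : \bar R | (0 <= x)%E}.

Section NNEReal.
Variable R : realType.

HB.instance Definition _ := SubChoice.on (nnereal R).
HB.instance Definition _ :=
  [SubChoice_isSubOrder of nnereal R by <: with Order.Disp tt tt].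

Definition nnereal0 : nnereal R := exist _ 0%E (lexx _).
Definition nnerealy : nnereal R := exist _ +oo%E (leey _).

Lemma nnereal_ge0 (x : nnereal R) : (nnereal0 <= x)%O.
Proof. exact: (valP x). Qed.

Lemma nnereal_ley (x : nnereal R) : (x <= nnerealy)%O.
Proof. exact: leey. Qed.

HB.instance Definition _ := Order.hasBottom.Build _ (nnereal R) nnereal_ge0.
HB.instance Definition _ := Order.hasTop.Build _ (nnereal R) nnereal_ley.

End NNEReal.

(* The lattice order is the opposite of the usual order of [0, +oo], so that ≼
   is the usual one: \top is the real 0 and \bot is +oo. *)
Definition ereal_frame (R : realType) : Type := ((nnereal R)^d)%type.

Section ERealFrame.
Variable R : realType.

HB.instance Definition _ := Order.TBTotal.on (ereal_frame R).

Definition ereal_val (r : ereal_frame R) : \bar R := val (r : nnereal R).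

Lemma ereal_leE (r s : ereal_frame R) :
  (s <= r)%O = (ereal_val r <= ereal_val s)%E.
Proof. by []. Qed.

Lemma ereal_bigjoin_subproof (A : set (ereal_frame R)) :
  (0 <= ereal_inf (ereal_val @` A))%E.
Proof. by apply: le_ereal_inf_tmp => _ [r _ <-]; exact: (valP (r : nnereal R)). Qed.

Definition ereal_bigjoin (A : set (ereal_frame R)) : ereal_frame R :=
  exist _ (ereal_inf (ereal_val @` A)) (ereal_bigjoin_subproof A).

Lemma ereal_bigjoin_ub (A : set (ereal_frame R)) x :
  A x -> (x <= ereal_bigjoin A)%O.
Proof. by move=> Ax; rewrite ereal_leE; apply: ereal_inf_lbound; exists x. Qed.

Lemma ereal_bigjoin_least (A : set (ereal_frame R)) y :
  (forall x, A x -> (x <= y)%O) -> (ereal_bigjoin A <= y)%O.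
Proof.
by move=> Ay; rewrite ereal_leE; apply: le_ereal_inf_tmp => _ [x /Ay xy <-].
Qed.

Lemma ereal_meet_bigjoin x (A : set (ereal_frame R)) :
  Order.meet x (ereal_bigjoin A) = ereal_bigjoin [set Order.meet x a | a in A].
Proof.
apply/eqP; rewrite eq_le; apply/andP; split; last first.
  apply: ereal_bigjoin_least => _ [a Aa <-].
  by rewrite leI2// ereal_bigjoin_ub.
case: (leP x (ereal_bigjoin A)) => [xA|Ax]; last first.
  apply: ereal_bigjoin_least => a Aa; apply: ereal_bigjoin_ub.
  by exists a => //; apply/meet_idPr/(le_trans (ereal_bigjoin_ub Aa))/ltW.
rewrite leNgt; apply/negP => ltx.
suff: (ereal_bigjoin A <= ereal_bigjoin [set Order.meet x a | a in A])%O.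
  by rewrite leNgt => /negP; apply; exact: lt_le_trans ltx xA.
apply: ereal_bigjoin_least => a Aa.
have : (Order.meet x a <= ereal_bigjoin [set Order.meet x a | a in A])%O.
  by apply: ereal_bigjoin_ub; exists a.
by rewrite leIx => /orP[|//]; rewrite leNgt ltx.
Qed.

HB.instance Definition _ := TBLattice_isFrame.Build _ (ereal_frame R)
  ereal_bigjoin_ub ereal_bigjoin_least ereal_meet_bigjoin.

End ERealFrame.

Record category := Category {
  ob :> Type;
  cathom : ob -> ob -> Type;
  catid : forall a, cathom a a;
  catcomp : forall a b c, cathom b c -> cathom a b -> cathom a c;
  catcomp1m : forall a b (f : cathom a b), catcomp (catid b) f = f;
  catcompm1 : forall a b (f : cathom a b), catcomp f (catid a) = f;
  catcompA : forall a b c d (h : cathom c d) (g : cathom b c) (f : cathom a b),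
    catcomp h (catcomp g f) = catcomp (catcomp h g) f
}.

Arguments cathom {_} _ _.
Arguments catid {_} _.
Arguments catcomp {_ _ _ _} _ _.

Record functor (C D : category) := Functor {
  fobj :> C -> D;
  fmor : forall a b : C, cathom a b -> cathom (fobj a) (fobj b);
  fmor1 : forall a, fmor (catid a) = catid (fobj a);
  fmorM : forall (a b c : C) (g : cathom b c) (f : cathom a b),
    fmor (catcomp g f) = catcomp (fmor g) (fmor f)
}.

Arguments fmor {_ _} _ {_ _} _.

Record nattrans (C D : category) (F G : functor C D) := NatTrans {
  component :> forall a : C, cathom (F a) (G a);
  naturality : forall (a b : C) (f : cathom a b),
    catcomp (component b) (fmor F f) = catcomp (fmor G f) (component a)
}.

Lemma nattrans_ext (C D : category) (F G : functor C D) (u v : nattrans F G) :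
  (forall a, u a = v a) -> u = v.
Proof.
case: u v => [u nu] [v nv] /= uv.
have {}uv : u = v by exact: functional_extensionality_dep.
by subst v; rewrite (Prop_irrelevance nu nv).
Qed.

Section FunctorCategory.
Variables C D : category.

Program Definition nat_id (F : functor C D) : nattrans F F :=
  @NatTrans C D F F (fun a => catid (F a)) _.
Next Obligation. by move=> *; rewrite /= catcomp1m catcompm1. Qed.

Program Definition nat_comp (F G H : functor C D)
    (v : nattrans G H) (u : nattrans F G) : nattrans F H :=
  @NatTrans C D F H (fun a => catcomp (v a) (u a)) _.
Next Obligation. by move=> *; rewrite /= -catcompA naturality catcompA naturality catcompA. Qed.

Program Definition functor_cat : category :=
  @Category (functor C D) (@nattrans C D) nat_id nat_comp _ _ _.
Next Obligation. by move=> *; apply: nattrans_ext => x; exact: catcomp1m. Qed.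
Next Obligation. by move=> *; apply: nattrans_ext => x; exact: catcompm1. Qed.
Next Obligation. by move=> *; apply: nattrans_ext => x; exact: catcompA. Qed.

End FunctorCategory.

Program Definition functor_comp (C D E : category)
    (G : functor D E) (F : functor C D) : functor C E :=
  @Functor C E (fun a => G (F a)) (fun a b f => fmor G (fmor F f)) _ _.
Next Obligation. by move=> *; rewrite /= !fmor1. Qed.
Next Obligation. by move=> *; rewrite /= !fmorM. Qed.

Program Definition postcomp (C D E : category) (F : functor D E) :
    functor (functor_cat C D) (functor_cat C E) :=
  @Functor (functor_cat C D) (functor_cat C E)
    (fun G : functor C D => functor_comp F G)
    (fun (G H : functor C D) (u : nattrans G H) =>
       @NatTrans C E (functor_comp F G) (functor_comp F H)
         (fun a => fmor F (u a)) _) _ _.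
Next Obligation. by move=> *; rewrite /= -!fmorM naturality. Qed.
Next Obligation. by move=> C D E F G; apply: nattrans_ext => x; exact: (fmor1 F). Qed.
Next Obligation. by move=> C D E F G H K v u; apply: nattrans_ext => x; exact: (fmorM F). Qed.

Definition opcat (C : category) : category :=
  @Category C (fun a b => @cathom C b a) (fun a => catid a)
    (fun a b c g f => catcomp f g)
    (fun a b f => catcompm1 f) (fun a b f => catcomp1m f)
    (fun a b c d h g f => esym (catcompA f g h)).

Program Definition full_subcat (C : category) (P : C -> Prop) : category :=
  @Category {a : C | P a} (fun a b => cathom (sval a) (sval b))
    (fun a => catid (sval a)) (fun a b c g f => catcomp g f) _ _ _.
Next Obligation. by move=> *; exact: catcomp1m. Qed.
Next Obligation. by move=> *; exact: catcompm1. Qed.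
Next Obligation. by move=> *; exact: catcompA. Qed.

Definition full_incl (C : category) (P : C -> Prop) :
    functor (full_subcat P) C :=
  @Functor (full_subcat P) C (fun a => sval a) (fun a b f => f)
    (fun=> erefl) (fun _ _ _ _ _ => erefl).

Definition type_cat : category :=
  @Category Type (fun A B => A -> B) (fun A => @id A)
    (fun A B C g f => g \o f) (fun _ _ _ => erefl) (fun _ _ _ => erefl)
    (fun _ _ _ _ _ _ _ => erefl).

Program Definition poset_cat d (V : porderType d) : category :=
  @Category V (fun s r => (s <= r)%O) (fun r => lexx r)
    (fun a b c bc ab => le_trans ab bc) _ _ _.
Next Obligation. by move=> *; exact: bool_irrelevance. Qed.
Next Obligation. by move=> *; exact: bool_irrelevance. Qed.
Next Obligation. by move=> *; exact: bool_irrelevance. Qed.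

(* The simplex category: the object n stands for the ordinal [n] = {0,...,n}. *)
Record delta_hom (m n : nat) := DeltaHom {
  delta_fun :> 'I_m.+1 -> 'I_n.+1;
  delta_mono : {homo delta_fun : i j / (i <= j)%N}
}.

Lemma delta_hom_ext m n (f g : delta_hom m n) : f =1 g -> f = g.
Proof.
case: f g => [f hf] [g hg] /= /funext fg.
by subst g; rewrite (Prop_irrelevance hf hg).
Qed.

Definition delta_id n : delta_hom n n := @DeltaHom n n id (fun _ _ ij => ij).

Definition delta_comp l m n (g : delta_hom m n) (f : delta_hom l m) :
  delta_hom l n :=
  @DeltaHom l n (g \o f) (fun _ _ ij => delta_mono g (delta_mono f ij)).

Program Definition Delta : category :=
  @Category nat delta_hom delta_id delta_comp _ _ _.
Next Obligation. by move=> *; exact: delta_hom_ext. Qed.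
Next Obligation. by move=> *; exact: delta_hom_ext. Qed.
Next Obligation. by move=> *; exact: delta_hom_ext. Qed.

Definition sSet : category := functor_cat (opcat Delta) type_cat.

Definition sPSh d (V : porderType d) : category :=
  functor_cat (opcat (poset_cat V)) sSet.

Definition simplices (X : sSet) (n : nat) : Type := fobj X n.

(* Simplicial sets of tuples: given T, a family of sets P n of (n+1)-tuples in
   T closed under reindexing along monotone maps.  The coface maps of Delta
   act by omitting an entry, the codegeneracies by repeating one. *)
Section TupleSSet.
Variables (T : Type) (P : forall n, set ('I_n.+1 -> T)).
Arguments P : clear implicits.
Hypothesis P_closed : forall m n (f : delta_hom m n) (x : 'I_n.+1 -> T),
  P n x -> P m (x \o f).

Definition tuple_reindex m n (f : delta_hom m n) (x : P n) : P m :=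
  exist _ (val x \o f) (mem_set (P_closed f (set_valP x))).

Program Definition tuple_sset : sSet :=
  @Functor (opcat Delta) type_cat (fun n => P n : Type)
    (fun n m f => @tuple_reindex m n f) _ _.
Next Obligation. by move=> *; apply/funext => x; apply: val_inj. Qed.
Next Obligation. by move=> *; apply/funext => x; apply: val_inj. Qed.

End TupleSSet.

Program Definition tuple_sset_map (T U : Type)
    (P : forall n, set ('I_n.+1 -> T)) (Q : forall n, set ('I_n.+1 -> U))
    (P_closed : forall m n (f : delta_hom m n) x, P n x -> P m (x \o f))
    (Q_closed : forall m n (f : delta_hom m n) x, Q n x -> Q m (x \o f))
    (g : T -> U) (gPQ : forall n x, P n x -> Q n (g \o x)) :
    @cathom sSet (tuple_sset P_closed) (tuple_sset Q_closed) :=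
  @NatTrans (opcat Delta) type_cat
    (tuple_sset P_closed) (tuple_sset Q_closed)
    (fun n (x : P n) => exist _ (g \o val x)
                          (mem_set (gPQ n _ (set_valP x)))) _.
Next Obligation. by move=> *; apply/funext => x; apply: val_inj. Qed.

Section Graphs.
Context {d : Order.disp_t}.

Record graph (V : frameType d) := Graph {
  vertex :> Type;
  dist : vertex -> vertex -> V;
  dist_refl : forall a, dist a a = \top%O
}.

Record graph_hom (V : frameType d) (X Y : graph V) := GraphHom {
  graph_fun :> X -> Y;
  graph_hom_le : forall a b, dist (graph_fun a) (graph_fun b) ≼ dist a b
}.

Variable V : frameType d.

Lemma graph_hom_ext (X Y : graph V) (f g : graph_hom X Y) : f =1 g -> f = g.
Proof.
case: f g => [f hf] [g hg] /= /funext fg.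
by subst g; rewrite (Prop_irrelevance hf hg).
Qed.

Program Definition graph_id (X : graph V) : graph_hom X X :=
  @GraphHom V X X id _.
Next Obligation. by move=> *; exact: lexx. Qed.

Program Definition graph_comp (X Y Z : graph V)
    (g : graph_hom Y Z) (f : graph_hom X Y) : graph_hom X Z :=
  @GraphHom V X Z (g \o f) _.
Next Obligation.
move=> X Y Z g f a b.
exact: le_trans (graph_hom_le f a b) (graph_hom_le g (f a) (f b)).
Qed.

Program Definition Gph : category :=
  @Category (graph V) (@graph_hom V) graph_id graph_comp _ _ _.
Next Obligation. by move=> *; exact: graph_hom_ext. Qed.
Next Obligation. by move=> *; exact: graph_hom_ext. Qed.
Next Obligation. by move=> *; exact: graph_hom_ext. Qed.

(* The empty meet is \top, i.e. the least element for ≼. *)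
Definition Nmax_simplices (X : graph V) (r : V) (n : nat) :
    set ('I_n.+1 -> X) :=
  [set x | exists rho : nat -> V,
     (\meet_(1 <= k < n.+1) rho k)%O ≼ r /\
     forall i j : 'I_n.+1, (i <= j)%N ->
       dist (x i) (x j) ≼ (\meet_(i.+1 <= k < j.+1) rho k)%O].

Lemma Nmax_simplicesP (X : graph V) (r : V) n (x : 'I_n.+1 -> X) :
  Nmax_simplices r x <->
  forall i j : 'I_n.+1, (i <= j)%N -> dist (x i) (x j) ≼ r.
Proof.
rewrite /leop; split=> [[rho [rho_r xrho]] i j ij|xr].
  apply: le_trans (xrho i j ij); rewrite big_nat; apply/meetsP_seq => k _ /andP[ik kj].
  apply: le_trans rho_r _; apply: meets_inf_seq => //.
  by rewrite mem_index_iota (leq_trans _ ik)//= (leq_trans kj)// ltn_ord.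
exists (fun=> r); split; first by rewrite /leop; apply/meetsP_seq.
move=> i j ij; rewrite /leop; have [<-|ij'] := eqVneq i j.
  by rewrite big_geq// dist_refl.
apply: le_trans (xr i j ij); apply: (@meets_inf_seq _ _ _ _ xpredT (fun=> r) i.+1) => //.
by rewrite mem_index_iota leqnn /= ltnS ltn_neqAle ij' ij.
Qed.

Lemma Nmax_reindex (X : graph V) (r : V) m n (f : delta_hom m n)
    (x : 'I_n.+1 -> X) :
  Nmax_simplices r x -> Nmax_simplices r (x \o f).
Proof.
move=> /Nmax_simplicesP xr; apply/Nmax_simplicesP => i j ij.
by apply: xr; exact: delta_mono.
Qed.

Lemma Nmax_mono (X : graph V) (r s : V) n (x : 'I_n.+1 -> X) :
  r ≼ s -> Nmax_simplices r x -> Nmax_simplices s (id \o x).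
Proof.
by move=> rs [rho [rho_r xrho]]; exists rho; split=> //; exact: le_trans rs rho_r.
Qed.

Lemma Nmax_vertexwise (X Y : graph V) (g : graph_hom X Y) (r : V) n
    (x : 'I_n.+1 -> X) :
  Nmax_simplices r x -> Nmax_simplices r (g \o x).
Proof.
move=> [rho [rho_r xrho]]; exists rho; split=> // i j ij.
exact: le_trans (xrho i j ij) (graph_hom_le g _ _).
Qed.

Definition Nmax_sset (X : graph V) (r : V) : sSet :=
  tuple_sset (@Nmax_reindex X r).

Program Definition Nmax_obj (X : graph V) : sPSh V :=
  @Functor (opcat (poset_cat V)) sSet (Nmax_sset X)
    (fun r s (rs : r ≼ s) =>
       @tuple_sset_map X X _ _ (@Nmax_reindex X r) (@Nmax_reindex X s) id
         (fun n x => @Nmax_mono X r s n x rs)) _ _.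
Next Obligation.
by move=> *; apply: nattrans_ext => n; apply/funext => x; apply: val_inj.
Qed.
Next Obligation.
by move=> *; apply: nattrans_ext => n; apply/funext => x; apply: val_inj.
Qed.

Program Definition Nmax : functor Gph (sPSh V) :=
  @Functor Gph (sPSh V) Nmax_obj
    (fun (X Y : graph V) (g : graph_hom X Y) =>
       @NatTrans (opcat (poset_cat V)) sSet (Nmax_obj X) (Nmax_obj Y)
         (fun r => tuple_sset_map (@Nmax_reindex X r) (@Nmax_reindex Y r)
            (@Nmax_vertexwise X Y g r)) _) _ _.
Next Obligation.
by move=> *; apply: nattrans_ext => n; apply/funext => x; apply: val_inj.
Qed.
Next Obligation.
move=> *; apply: nattrans_ext => r; apply: nattrans_ext => n.
by apply/funext => x; apply: val_inj.
Qed.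
Next Obligation.
move=> *; apply: nattrans_ext => r; apply: nattrans_ext => n.
by apply/funext => x; apply: val_inj.
Qed.

End Graphs.

Section Metric.
Variable R : realType.

Definition l1_metric (X : graph (ereal_frame R)) : Prop :=
  forall a b c : X,
    (ereal_val (dist a c) <= ereal_val (dist a b) + ereal_val (dist b c))%E.

Definition symmetric_graph (X : graph (ereal_frame R)) : Prop :=
  forall a b : X, dist a b = dist b a.

Definition strict_graph (X : graph (ereal_frame R)) : Prop :=
  forall a b : X, ereal_val (dist a b) = 0%E -> a = b.

(* Distances may be +oo, as for any graph over ereal_frame. *)
Definition honest_metric (X : graph (ereal_frame R)) : Prop :=
  [/\ l1_metric X, symmetric_graph X & strict_graph X].

Definition Met : category := @full_subcat (Gph (ereal_frame R)) honest_metric.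

Definition Met_incl : functor Met (Gph (ereal_frame R)) :=
  @full_incl (Gph (ereal_frame R)) honest_metric.

End Metric.

Record scpx := SCpxObj {
  sc_vertex :> Type;
  sc_simplex : set (set sc_vertex);
  sc_finite : forall s, sc_simplex s -> finite_set s;
  sc_nonempty : forall s, sc_simplex s -> s !=set0;
  sc_down : forall s t, sc_simplex s -> t `<=` s -> t !=set0 -> sc_simplex t;
  sc_singleton : forall v, sc_simplex [set v]
}.

Record scpx_hom (K L : scpx) := SCpxHom {
  sc_fun :> K -> L;
  sc_hom_simplex : forall s, sc_simplex s -> sc_simplex (sc_fun @` s)
}.

Lemma scpx_hom_ext (K L : scpx) (f g : scpx_hom K L) : f =1 g -> f = g.
Proof.
case: f g => [f hf] [g hg] /= /funext fg.
by subst g; rewrite (Prop_irrelevance hf hg).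
Qed.

Program Definition scpx_id (K : scpx) : scpx_hom K K := @SCpxHom K K id _.
Next Obligation. by move=> K s; rewrite image_id. Qed.

Program Definition scpx_comp (K L M : scpx)
    (g : scpx_hom L M) (f : scpx_hom K L) : scpx_hom K M :=
  @SCpxHom K M (g \o f) _.
Next Obligation.
by move=> K L M g f s Ks; rewrite -image_comp; do 2! apply: sc_hom_simplex.
Qed.

Program Definition SCpx : category :=
  @Category scpx scpx_hom scpx_id scpx_comp _ _ _.
Next Obligation. by move=> *; exact: scpx_hom_ext. Qed.
Next Obligation. by move=> *; exact: scpx_hom_ext. Qed.
Next Obligation. by move=> *; exact: scpx_hom_ext. Qed.

Definition Sing_simplices (K : scpx) (n : nat) : set ('I_n.+1 -> K) :=
  [set x | sc_simplex (range x)].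

Lemma Sing_reindex (K : scpx) m n (f : delta_hom m n) (x : 'I_n.+1 -> K) :
  Sing_simplices x -> Sing_simplices (x \o f).
Proof.
move=> xK; apply: sc_down xK _ _; first by move=> _ [i _ <-]; exists (f i).
by exists (x (f ord0)); exists ord0.
Qed.

Lemma Sing_vertexwise (K L : scpx) (g : scpx_hom K L) n (x : 'I_n.+1 -> K) :
  Sing_simplices x -> Sing_simplices (g \o x).
Proof.
by move=> /(sc_hom_simplex g); rewrite /Sing_simplices /= image_comp.
Qed.

Program Definition Sing : functor SCpx sSet :=
  @Functor SCpx sSet (fun K : scpx => tuple_sset (@Sing_reindex K))
    (fun (K L : scpx) (g : scpx_hom K L) =>
       tuple_sset_map (@Sing_reindex K) (@Sing_reindex L)
         (@Sing_vertexwise K L g)) _ _.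
Next Obligation.
by move=> *; apply: nattrans_ext => n; apply/funext => x; apply: val_inj.
Qed.
Next Obligation.
by move=> *; apply: nattrans_ext => n; apply/funext => x; apply: val_inj.
Qed.

Section VietorisRips.
Variable R : realType.
Let RR := ereal_frame R.

Program Definition VR_complex (X : Met R) (r : RR) : scpx :=
  @SCpxObj (vertex (sval X))
    [set s | [/\ finite_set s, s !=set0 &
                 forall a b, s a -> s b -> dist a b ≼ r]] _ _ _ _.
Next Obligation. by move=> X r s []. Qed.
Next Obligation. by move=> X r s []. Qed.
Next Obligation.
move=> [X ?] r s t [fs _ sr] ts t0; split=> //=; first exact: sub_finite_set fs.
by move=> a b /ts sa /ts sb; exact: sr.
Qed.
Next Obligation.
move=> [X ?] r v; split=> /=; [exact: finite_set1|by exists v|].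
by move=> _ _ -> ->; rewrite /leop dist_refl lex1.
Qed.

Program Definition VR_incl (X : Met R) (r s : RR) (rs : r ≼ s) :
    scpx_hom (VR_complex X r) (VR_complex X s) :=
  @SCpxHom (VR_complex X r) (VR_complex X s) id _.
Next Obligation.
move=> [X ?] r s rs t [ft t0 tr]; rewrite image_id; split=> // a b ta tb.
exact: le_trans rs (tr a b ta tb).
Qed.

Program Definition VR_obj (X : Met R) :
    functor_cat (opcat (poset_cat RR)) SCpx :=
  @Functor (opcat (poset_cat RR)) SCpx (VR_complex X) (@VR_incl X) _ _.
Next Obligation. by move=> X r; apply: scpx_hom_ext. Qed.
Next Obligation. by move=> X r s t rs st; apply: scpx_hom_ext. Qed.

Program Definition VR_map (X Y : Met R) (f : cathom X Y) (r : RR) :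
    scpx_hom (VR_complex X r) (VR_complex Y r) :=
  @SCpxHom (VR_complex X r) (VR_complex Y r) (graph_fun f) _.
Next Obligation.
move=> X Y f r s [fs [v sv] sr]; split; first exact: finite_image.
  by exists (f v), v.
move=> _ _ [a sa <-] [b sb <-].
exact: le_trans (sr a b sa sb) (graph_hom_le f a b).
Qed.

Program Definition VR :
    functor (Met R) (functor_cat (opcat (poset_cat RR)) SCpx) :=
  @Functor (Met R) (functor_cat (opcat (poset_cat RR)) SCpx) VR_obj
    (fun X Y f => @NatTrans (opcat (poset_cat RR)) SCpx (VR_obj X) (VR_obj Y)
       (VR_map f) _) _ _.
Next Obligation. by move=> X Y f r s rs; apply: scpx_hom_ext. Qed.
Next Obligation.
by move=> X; apply: nattrans_ext => r; apply: scpx_hom_ext.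
Qed.
Next Obligation.
by move=> X Y Z g f; apply: nattrans_ext => r; apply: scpx_hom_ext.
Qed.

End VietorisRips.

Definition std_simplex (R : realType) (n : nat) : set {ptws 'I_n.+1 -> R} :=
  [set t | (forall i, 0 <= t i) /\ \sum_(i < n.+1) t i = 1].

Arguments std_simplex : clear implicits.

Section StandardSimplex.
Variable R : realType.

Definition push_coords m n (f : delta_hom m n) (t : 'I_m.+1 -> R) :
    'I_n.+1 -> R :=
  fun j => \sum_(i < m.+1 | f i == j) t i.

Lemma push_coords_simplex m n (f : delta_hom m n) (t : 'I_m.+1 -> R) :
  std_simplex R m t -> std_simplex R n (push_coords f t).
Proof.
move=> [t0 t1]; split=> [j|]; first exact: sumr_ge0.
by rewrite -t1 [RHS](partition_big (delta_fun f) xpredT).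
Qed.

Definition std_simplex_map m n (f : delta_hom m n) (t : std_simplex R m) :
    std_simplex R n :=
  exist _ (push_coords f (val t))
    (mem_set (push_coords_simplex f (set_valP t))).

End StandardSimplex.

(* |X| is the quotient of the coproduct of the spaces X_n x Delta^n, with X_n
   discrete, by the equivalence relation generated by
   (f^* x, t) ~ (x, f_* t).  As X_n is discrete, the coproduct is the disjoint
   union of copies of Delta^n indexed by pairs (n, x) with x in X_n. *)
Section SSetRealization.
Variables (R : realType) (X : sSet).

Definition sset_cells : topologicalType :=
  {s : {classic {n : nat & simplices X n}} &
     set_type (std_simplex R (tag s))}.

Definition sset_point (n : nat) (x : simplices X n)
    (t : std_simplex R n) : sset_cells :=
  existT (fun s : {classic {n : nat & simplices X n}} =>
            set_type (std_simplex R (tag s)))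
    (Tagged (simplices X) x) t.

Inductive sset_glue : sset_cells -> sset_cells -> Prop :=
  SSetGlue m n (f : delta_hom m n) (x : simplices X n)
    (t : std_simplex R m) :
    sset_glue (sset_point (fmor X f x) t)
              (sset_point x (std_simplex_map f t)).

Definition sset_rel : rel sset_cells :=
  fun p q => `[< Relation_Operators.clos_refl_sym_trans _ sset_glue p q >].

Lemma sset_rel_refl : reflexive sset_rel.
Proof. by move=> p; apply/asboolP; exact: Relation_Operators.rst_refl. Qed.

Lemma sset_rel_sym : symmetric sset_rel.
Proof. by move=> p q; apply/asboolP/asboolP => ?; exact: Relation_Operators.rst_sym. Qed.

Lemma sset_rel_trans : transitive sset_rel.
Proof.
move=> q p s /asboolP pq /asboolP qs; apply/asboolP; exact: Relation_Operators.rst_trans pq qs.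
Qed.

Canonical sset_equiv := EquivRel sset_rel
  sset_rel_refl sset_rel_sym sset_rel_trans.

Definition sset_realization : topologicalType :=
  quotient_topology {eq_quot sset_equiv}.

End SSetRealization.

(* {classic _} only adds a choice structure to the vertices, for the sum.
   |K| is the set of barycentric coordinates t : K -> [0, 1] whose support is a
   simplex, with the coherent (weak) topology: U is open iff its trace on each
   closed simplex |s| is open for the Euclidean topology of |s|, which, s being
   finite, is the one induced by pointwise convergence. *)
Section SCpxRealization.
Variables (R : realType) (K : scpx).

Definition sc_point : set {ptws {classic K} -> R} :=
  [set t | [/\ forall v, 0 <= t v, sc_simplex [set v | t v != 0] &
               \sum_(v \in [set: {classic K}]) t v = 1]].

Definition sc_points : Type := set_type sc_point.

Definition closed_simplex (s : set K) : set sc_points :=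
  [set t | [set v | val t v != 0] `<=` s].

Definition coherent_open : set_system sc_points :=
  [set U | forall s, sc_simplex s ->
     exists2 O : set {ptws {classic K} -> R}, open O &
       closed_simplex s `&` U = closed_simplex s `&` val @^-1` O].

Lemma coherent_openT : coherent_open setT.
Proof. by move=> s _; exists setT; [exact: openT|rewrite preimage_setT]. Qed.

Lemma coherent_openI : setI_closed coherent_open.
Proof.
move=> U W oU oW s Ks; have [A oA UA] := oU s Ks; have [B oB WB] := oW s Ks.
exists (A `&` B); first exact: openI.
by rewrite preimage_setI setIIr UA WB -setIIr.
Qed.

Lemma coherent_open_bigU (I : Type) (U : I -> set sc_points) :
  (forall i, coherent_open (U i)) -> coherent_open (\bigcup_i U i).
Proof.
move=> oU s Ks.
have /choice[W WP] : forall i, exists O : set {ptws {classic K} -> R}, open O /\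
    closed_simplex s `&` U i = closed_simplex s `&` val @^-1` O.
  by move=> i; have [W oW UW] := oU i s Ks; exists W.
exists (\bigcup_i W i); first by apply: bigcup_open => i _; case: (WP i).
rewrite preimage_bigcup !setI_bigcupr; apply: eq_bigcupr => i _.
by case: (WP i).
Qed.

HB.instance Definition _ := Choice.on sc_points.
HB.instance Definition _ := isOpenTopological.Build sc_points
  coherent_openT coherent_openI coherent_open_bigU.

Definition scpx_realization : topologicalType := sc_points.

End SCpxRealization.

Definition homeomorphic (S T : topologicalType) : Prop :=
  exists (f : S -> T) (g : T -> S),
    [/\ continuous f, continuous g, cancel f g & cancel g f].

Definition homotopic (R : realType) (S T : topologicalType) (f g : S -> T) :
    Prop :=
  exists H : S * R -> T,
    [/\ {within [set: S] `*` `[0, 1], continuous H},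
        forall x, H (x, 0) = f x & forall x, H (x, 1) = g x].

Definition homotopy_equivalent (R : realType) (S T : topologicalType) : Prop :=
  exists (f : S -> T) (g : T -> S),
    [/\ continuous f, continuous g,
        homotopic R (g \o f) id & homotopic R (f \o g) id].

(* Main.v *)
(* For a family P of tuples of vertices of a simplicial complex K that spans
   simplices and contains every monotone simplex tuple (for a chosen total
   order), barycentric coordinates give a map p from the realization of the
   simplicial set P to |K|.  Sorting the support of a point gives a section j
   of p.  When all tuples of P are monotone, j is inverse to p; this applies to
   the graph X' obtained from X by setting X'(a,b) = oo unless a <= b.  When P
   consists of all simplex tuples, a point of |P| is a weighted word in the
   vertices of a simplex, and j o p sorts it; moving the weights from the word
   to a sorted copy appended at the end is a homotopy between id and j o p. *)
Require Import Defs.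
From HB Require Import structures.
From mathcomp Require Import all_boot all_order all_algebra generic_quotient finmap.
From mathcomp Require Import all_classical all_reals all_analysis wochoice.

Set Implicit Arguments.
Unset Strict Implicit.
Unset Printing Implicit Defensive.

Import Order.TTheory GRing.Theory Num.Theory.
Import numFieldNormedType.Exports.

Local Open Scope classical_set_scope.
Local Open Scope ring_scope.
Local Open Scope quotient_scope.

(** * Monotone tuples *)

Lemma total_order_exists (T : eqType) : exists le : rel T, total_order le.
Proof.
have [le wo_le] := well_ordering_principle T.
have wo : wo_chain le predT by move=> A _; exact: wo_le.
have le_refl x : le x x by apply: (wo_chain_reflexive wo).
have le_anti : antisymmetric le.
  by move=> x y; apply: (wo_chain_antisymmetric wo).
have le_total x y : le x y || le y x by apply: (wo_chainW wo).
exists le; split=> //; split=> //; split=> // y x z xy yz.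
(* Transitivity is read off the least element of {x, y, z}: if it is x, then x <= z at once; if it
   is y or z, antisymmetry identifies it with the element before it. *)
have /wo_le[w [[]]] : nonempty [mem [:: x; y; z]].
  by exists x; exact: mem_head.
rewrite !inE => /or3P[] /eqP-> w_le _.
- by apply: w_le; rewrite !inE eqxx !orbT.
- have yx : le y x by apply: w_le; rewrite !inE eqxx.
  by rewrite (le_anti x y)// xy yx.
- have zy : le z y by apply: w_le; rewrite !inE eqxx orbT.
  by rewrite (le_anti z y)// zy yz.
Qed.

Section MonotoneTuples.
Variables (T : choiceType) (le : rel T).
Hypothesis le_order : total_order le.

Definition monotone_tuple n (x : 'I_n.+1 -> T) :=
  forall i j : 'I_n.+1, (i <= j)%N -> le (x i) (x j).

Lemma monotone_enum (s : set T) : finite_set s -> s !=set0 ->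
  exists k (y : 'I_k.+1 -> T), [/\ monotone_tuple y, injective y & range y = s].
Proof.
have [[[le_refl le_trans] le_anti] le_tot] := le_order.
move=> /finite_fsetP[X ->] [x0 x0X].
pose e := sort le (enum_fset X).
(* Tuples indexed by ['I_k.+1] have k + 1 entries; s being nonempty, k can be the size minus one. *)
have size_e : size e = (size e).-1.+1.
  rewrite prednK// size_sort lt0n size_eq0; apply: contraTneq x0X => X0.
  by apply/negP; rewrite /= -[_ \in _]/(x0 \in enum_fset X) X0.
have mem_e v : (v \in e) = (v \in X) by rewrite mem_sort.
have lt_e (i : 'I_(size e).-1.+1) : (i < size e)%N.
  exact: leq_trans (ltn_ord i) (eq_leq (esym size_e)).
exists (size e).-1, (fun i => nth x0 e i); split.
- by move=> i j ij; apply: sorted_leq_nth => //; [exact: sort_sorted|exact: lt_e..].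
- move=> i j /eqP; rewrite nth_uniq// ?sort_uniq ?fset_uniq//.
  by move=> /eqP/ord_inj.
- apply/seteqP; split=> [_ [i _ <-]|v]/=; first by rewrite -mem_e mem_nth.
  rewrite -mem_e => ve; have ltv : (index v e < (size e).-1.+1)%N.
    by rewrite -size_e index_mem.
  by exists (Ordinal ltv) => //=; rewrite nth_index.
Qed.

(** Every entry of x has an index in y, which gives f. If f reversed two indices, antisymmetry would
    make the corresponding entries of y equal, against injectivity. Face and degeneracy maps between
    monotone tuples are obtained from this lemma. *)
Lemma monotone_factor m k (x : 'I_m.+1 -> T) (y : 'I_k.+1 -> T) :
  monotone_tuple x -> monotone_tuple y -> injective y -> range x `<=` range y ->
  exists f : delta_hom m k, x = y \o f.
Proof.
have [[_ le_anti] _] := le_order; move=> x_mono y_mono y_inj xy.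
have /choice[f fE] : forall i, exists j, y j = x i.
  by move=> i; have [|j _ <-] := xy (x i); [exists i|exists j].
suff f_mono : {homo f : i j / (i <= j)%N}.
  by exists (DeltaHom f_mono); apply/funext => i /=; rewrite fE.
move=> i j ij; rewrite leqNgt; apply/negP => ltf.
have /y_inj fij : y (f i) = y (f j).
  by apply: le_anti; rewrite {1}[y (f i)]fE {1}[y (f j)]fE x_mono//= y_mono// ltnW.
by rewrite fij ltnn in ltf.
Qed.

Lemma range_enum_exists n (x : 'I_n.+1 -> T) : exists k (y : 'I_k.+1 -> T),
  [/\ monotone_tuple y, injective y & range y = range x].
Proof. by apply: monotone_enum; [exact: finite_image|exists (x ord0), ord0]. Qed.

(** One sorted enumeration is fixed for each tuple, because the sorting homotopy is defined by a
    formula on cells. *)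
Definition range_size n (x : 'I_n.+1 -> T) : nat := sval (cid (range_enum_exists x)).

Definition range_enum n (x : 'I_n.+1 -> T) : 'I_(range_size x).+1 -> T :=
  sval (cid (svalP (cid (range_enum_exists x)))).

Arguments range_enum [n] x.

Lemma range_enumP n (x : 'I_n.+1 -> T) :
  [/\ monotone_tuple (range_enum x), injective (range_enum x) &
      range (range_enum x) = range x].
Proof. exact: (svalP (cid (svalP (cid (range_enum_exists x))))). Qed.

End MonotoneTuples.

Arguments range_enum [T le] le_order [n] x.

(** * Concatenation of tuples and ordinal sums of monotone maps *)

Section TupleJoin.

(** The index type is convertible to ['I_(m.+1 + n.+1)], but has the successor form that simplices
    and [delta_hom] require. *)
Definition tuple_join (S : Type) m n (x : 'I_m.+1 -> S) (y : 'I_n.+1 -> S)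
    (i : 'I_(m + n.+1).+1) : S :=
  match fintype.split (i : 'I_(m.+1 + n.+1)) with inl a => x a | inr b => y b end.

Definition join_inl m n (a : 'I_m.+1) : 'I_(m + n.+1).+1 := lshift n.+1 a.

Definition join_inr m n (b : 'I_n.+1) : 'I_(m + n.+1).+1 := rshift m.+1 b.

Lemma join_ind m n (Q : 'I_(m + n.+1).+1 -> Prop) :
  (forall a, Q (join_inl n a)) -> (forall b, Q (join_inr m b)) -> forall i, Q i.
Proof.
move=> Ql Qr i; rewrite -[i](@splitK m.+1 n.+1).
by case: fintype.split => [a|b]; [exact: Ql|exact: Qr].
Qed.

Lemma tuple_joinl (S : Type) m n (x : 'I_m.+1 -> S) (y : 'I_n.+1 -> S) a :
  tuple_join x y (join_inl n a) = x a.
Proof. by rewrite /tuple_join (unsplitK (inl a)). Qed.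

Lemma tuple_joinr (S : Type) m n (x : 'I_m.+1 -> S) (y : 'I_n.+1 -> S) b :
  tuple_join x y (join_inr m b) = y b.
Proof. by rewrite /tuple_join (unsplitK (inr b)). Qed.

Lemma range_tuple_join (S : Type) m n (x : 'I_m.+1 -> S) (y : 'I_n.+1 -> S) :
  range (tuple_join x y) = range x `|` range y.
Proof.
apply/seteqP; split=> [_ [i _ <-]|v [] [i _ <-]].
- elim/join_ind: i => [a|b]; first by left; rewrite tuple_joinl; exists a.
  by right; rewrite tuple_joinr; exists b.
- by exists (join_inl n i); rewrite ?tuple_joinl.
- by exists (join_inr m i); rewrite ?tuple_joinr.
Qed.

Lemma join_inl_mono m n : {homo @join_inl m n : i j / (i <= j)%N}.
Proof. by []. Qed.

Lemma join_inr_mono m n : {homo @join_inr m n : i j / (i <= j)%N}.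
Proof. by move=> i j; rewrite /= leq_add2l. Qed.

Definition delta_inl m n : delta_hom m (m + n.+1) := DeltaHom (@join_inl_mono m n).

Definition delta_inr m n : delta_hom n (m + n.+1) := DeltaHom (@join_inr_mono m n).

Lemma delta_join_mono m n m' n' (f : delta_hom m m') (g : delta_hom n n') :
  {homo tuple_join (delta_inl m' n' \o f) (delta_inr m' n' \o g) :
    i j / (i <= j)%N}.
Proof.
move=> i j; elim/join_ind: i => a; elim/join_ind: j => b;
  rewrite ?tuple_joinl ?tuple_joinr /= ?leq_add2l => ab.
- exact: delta_mono.
- by rewrite (leq_trans (ltnW (ltn_ord (f a))))// leq_addr.
(* An index of the right block never lies below one of the left block. *)
- by have := leq_ltn_trans (leq_trans (leq_addr _ _) ab) (ltn_ord b); rewrite ltnn.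
- exact: delta_mono.
Qed.

Definition delta_join m n m' n' (f : delta_hom m m') (g : delta_hom n n') :
  delta_hom (m + n.+1) (m' + n'.+1) := DeltaHom (@delta_join_mono m n m' n' f g).

Lemma tuple_join_comp (S : Type) m n m' n' (x : 'I_m'.+1 -> S) (y : 'I_n'.+1 -> S)
    (f : delta_hom m m') (g : delta_hom n n') :
  tuple_join (x \o f) (y \o g) = tuple_join x y \o delta_join f g.
Proof.
apply/funext; elim/join_ind => a /=.
  by rewrite !tuple_joinl.
by rewrite !tuple_joinr.
Qed.

End TupleJoin.

(** * Pushforward of weights along a tuple *)

Section Push.
Variable V : nmodType.

(** The image measure of the weights t: for a tuple of vertices these are barycentric coordinates,
    and for a [delta_hom] this is [push_coords]. *)
Definition push (I : finType) (T : eqType) (x : I -> T) (t : I -> V) (v : T) : V :=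
  \sum_(i | x i == v) t i.

Lemma push_comp (I J : finType) (T : eqType) (x : J -> T) (f : I -> J)
  (t : I -> V) : push (x \o f) t = push x (push f t).
Proof.
apply/funext => v; rewrite /push [LHS](partition_big f (fun j => x j == v))//=.
apply: eq_bigr => j /eqP xj; apply: eq_bigl => i.
by rewrite /= andb_idl// => /eqP ->; rewrite xj.
Qed.

Lemma push_injE (I : finType) (T : eqType) (x : I -> T) (t : I -> V) i :
  injective x -> push x t (x i) = t i.
Proof.
by move=> x_inj; rewrite /push (big_pred1 i)// => j; rewrite (inj_eq x_inj).
Qed.

Lemma push_supp (I : finType) (T : eqType) (x : I -> T) (t : I -> V) :
  [set v | push x t v != 0] `<=` range x.
Proof.
move=> v /= tv; apply: contrapT => xv; move/eqP: tv; apply.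
by rewrite /push big_pred0// => i; apply/eqP => xi; apply: xv; exists i.
Qed.

Lemma push_pull (I : finType) (T : eqType) (x : I -> T) (u : T -> V) :
  injective x -> [set v | u v != 0] `<=` range x -> push x (u \o x) = u.
Proof.
move=> x_inj ux; apply/funext => v; have [uv|uv] := eqVneq (u v) 0.
  by rewrite uv /push big1// => i /eqP xi /=; rewrite xi.
by have [i _ <-] := ux v uv; rewrite push_injE.
Qed.

Lemma push_sum (I : finType) (T : choiceType) (x : I -> T) (t : I -> V) :
  \sum_(v \in [set: T]) push x t v = \sum_i t i.
Proof.
(* The pushforward vanishes off the range of x, so the sum over T becomes a finite one; after
   exchanging sums, each i contributes exactly once. *)
have fx : finite_set (range x) by exact: finite_image.
rewrite -(fsbig_widen (range x))//; last first.
  by move=> v [_ xv] /=; apply: contrapT => /eqP/push_supp.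
rewrite fsbig_finite// /push (exchange_big_dep xpredT)//=.
apply: eq_bigr => i _; rewrite (eq_bigl (pred1 (x i))) => [|v]; last exact: eq_sym.
rewrite -big_filter filter_pred1_uniq ?fset_uniq ?big_seq1// in_fset_set// inE.
by exists i.
Qed.

Lemma pull_sum (I : finType) (T : choiceType) (x : I -> T) (u : T -> V) :
  injective x -> [set v | u v != 0] `<=` range x ->
  \sum_i u (x i) = \sum_(v \in [set: T]) u v.
Proof. by move=> x_inj ux; rewrite -[in RHS](push_pull x_inj ux) push_sum. Qed.

End Push.

Section PushJoin.
Variable V : nmodType.

Lemma big_join m n (Q : pred 'I_(m + n.+1).+1) (F : 'I_(m + n.+1).+1 -> V) :
  \sum_(i | Q i) F i =
    \sum_(a | Q (join_inl n a)) F (join_inl n a) +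
    \sum_(b | Q (join_inr m b)) F (join_inr m b).
Proof. exact: (@big_split_ord V 0 +%R m.+1 n.+1). Qed.

Lemma join_inl_eq m n (a b : 'I_m.+1) : (join_inl n a == join_inl n b) = (a == b).
Proof. exact: (@eq_lshift m.+1 n.+1). Qed.

Lemma join_inr_eq m n (a b : 'I_n.+1) : (join_inr m a == join_inr m b) = (a == b).
Proof. exact: (@eq_rshift m.+1 n.+1). Qed.

Lemma join_inlr m n (a : 'I_m.+1) (b : 'I_n.+1) :
  (join_inl n a == join_inr m b) = false.
Proof. exact: (@eq_lrshift m.+1 n.+1). Qed.

Lemma join_inrl m n (a : 'I_m.+1) (b : 'I_n.+1) :
  (join_inr m b == join_inl n a) = false.
Proof. exact: (@eq_rlshift m.+1 n.+1). Qed.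

Lemma push_delta_join m n m' n' (f : delta_hom m m') (g : delta_hom n n')
    (t : 'I_m.+1 -> V) (u : 'I_n.+1 -> V) :
  push (delta_join f g) (tuple_join t u) = tuple_join (push f t) (push g u).
Proof.
apply/funext; elim/join_ind => a; rewrite /push big_join.
- rewrite tuple_joinl [X in _ + X]big_pred0 ?addr0 => [|b]; last first.
    by rewrite /= tuple_joinr join_inrl.
  apply: eq_big => b; last by rewrite tuple_joinl.
  by rewrite /= tuple_joinl join_inl_eq.
- rewrite tuple_joinr [X in X + _]big_pred0 ?add0r => [|b]; last first.
    by rewrite /= tuple_joinl join_inlr.
  apply: eq_big => b; last by rewrite tuple_joinr.
  by rewrite /= tuple_joinr join_inr_eq.
Qed.

(** With the gluing relation, this lets a concatenated word drop a block of weight zero; the two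
    ends of the homotopy are computed in this way. *)
Lemma push_delta_inl m n (t : 'I_m.+1 -> V) :
  push (delta_inl m n) t = tuple_join t (fun=> 0).
Proof.
apply/funext; elim/join_ind => a; rewrite /push.
  by rewrite tuple_joinl (big_pred1 a)// => b; exact: join_inl_eq.
by rewrite tuple_joinr big_pred0// => b; exact: join_inlr.
Qed.

Lemma push_delta_inr m n (t : 'I_n.+1 -> V) :
  push (delta_inr m n) t = tuple_join (fun=> 0) t.
Proof.
apply/funext; elim/join_ind => a; rewrite /push.
  by rewrite tuple_joinl big_pred0// => b; exact: join_inrl.
by rewrite tuple_joinr (big_pred1 a)// => b; exact: join_inr_eq.
Qed.

End PushJoin.

(** * Continuity *)

Lemma ptws_continuous (S Z : topologicalType) (I : eqType)
    (f : S -> {ptws I -> Z}) :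
  (forall i, continuous (fun s => f s i)) -> continuous f.
Proof.
move=> fc s; apply/cvg_sup => i U [_ [[B oB <-] /= Bfs] BU].
by apply: filterS BU _; apply: fc; exact: open_nbhs_nbhs.
Qed.

Lemma ptws_eval_continuous (Z : topologicalType) (I : eqType) (i : I) :
  continuous (fun f : {ptws I -> Z} => f i).
Proof. exact: (@proj_continuous I (fun=> Z) i). Qed.

Lemma set_type_continuous (S Z : topologicalType) (A : set Z) (f : S -> A) :
  continuous (fun s => val (f s)) -> continuous f.
Proof. exact: continuous_comp_initial. Qed.

Lemma val_continuous (Z : topologicalType) (A : set Z) :
  continuous (val : A -> Z).
Proof. exact: initial_continuous. Qed.

Lemma fun_comp_continuous (S1 S2 S3 : topologicalType) (f : S1 -> S2)
    (g : S2 -> S3) :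
  continuous f -> continuous g -> continuous (fun s => g (f s)).
Proof. by move=> fc gc s; exact: continuous_comp (fc s) (gc (f s)). Qed.

Lemma fst_continuous (S1 S2 : topologicalType) : continuous (@fst S1 S2).
Proof. by move=> s; exact: cvg_fst. Qed.

Lemma snd_continuous (S1 S2 : topologicalType) : continuous (@snd S1 S2).
Proof. by move=> s; exact: cvg_snd. Qed.

Lemma fun_pair_continuous (S S1 S2 : topologicalType) (f : S -> S1) (g : S -> S2) :
  continuous f -> continuous g -> continuous (fun s => (f s, g s)).
Proof. by move=> fc gc s; exact: cvg_pair (fc s) (gc s). Qed.

Lemma fun_sum_continuous (R : realType) (S : topologicalType) (I : finType)
    (P : pred I) (f : I -> S -> R) :
  (forall i, continuous (f i)) ->
  continuous (fun s => \sum_(i | P i) f i s).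
Proof. by move=> fc; apply: continuous_big => //; exact: add_continuous. Qed.

Lemma fun_mul_continuous (R : realType) (S : topologicalType) (f g : S -> R) :
  continuous f -> continuous g -> continuous (fun s => f s * g s).
Proof. by move=> fc gc s; exact: continuousM (fc s) (gc s). Qed.

Lemma fun_sub_continuous (R : realType) (S : topologicalType) (f g : S -> R) :
  continuous f -> continuous g -> continuous (fun s => f s - g s).
Proof. by move=> fc gc s; exact: cvgB (fc s) (gc s). Qed.

(** Each summand is open in the disjoint sum, so a product neighbourhood in [X i * L] maps onto a
    neighbourhood in the product of the sum with L. *)
Lemma sigT_prod_continuous (I : choiceType) (X : I -> topologicalType)
    (L Z : topologicalType) (f : {i & X i} * L -> Z) :
  (forall i, continuous (fun p : X i * L => f (existT X i p.1, p.2))) ->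
  continuous f.
Proof.
move=> fc [[i x] s] W /(fc i (x, s)) [[A B] /= [xA sB] ABW].
exists (existT X i @` A, B) => /=; first by split=> //; exact: existT_nbhs.
by move=> [_ s'] /= [[a Aa <-] Bs']; exact: (ABW (a, s')).
Qed.

(* By the tube lemma, applied to a compact neighbourhood in R. *)
Lemma quotient_prod_continuous (R : realType) (C Z : topologicalType)
    (Q : quotType C) (f : quotient_topology Q * R -> Z) :
  continuous (fun p : C * R => f (\pi_(quotient_topology Q)%qT p.1, p.2)) ->
  continuous f.
Proof.
set g := fun p => _ => gc [q s] W.
rewrite nbhsE => -[W' [oW' W'q] W'W].
have q_repr : f (q, s) = g (repr q, s) by rewrite /g /= reprK.
have : nbhs (repr q, s) (g @^-1` W').
  by apply: gc; apply: open_nbhs_nbhs; split=> //; rewrite -q_repr.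
move=> [[A B] /= [qA sB] ABW].
have /nbhs_closedballP[e eB] := sB.
pose J := closed_ball s e%:num.
have cJ : compact J by exact: closed_ballR_compact.
pose U := [set x | forall t, J t -> W' (f (x, t))].
(* Openness in the quotient is openness of the preimage in C; compactness of J yields one
   neighbourhood of c that works for all t in J. *)
have oU : open U.
  rewrite /open/= /quotient_open openE => c Uc.
  move/compact_near_coveringP : cJ; apply => t Jt.
  have : nbhs (c, t) (g @^-1` W').
    by apply: gc; apply: open_nbhs_nbhs; split=> //; exact: Uc.
  move=> [[A1 B1] /= [cA tB] AB1W]; exists (B1, A1) => //= -[t' c'] /= [? ?].
  exact: (AB1W (c', t')).
exists (U, J) => /=.
  split; last by apply/nbhs_closedballP; exists e.
  apply: open_nbhs_nbhs; split=> // t Jt.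
  have := ABW (repr q, t); rewrite /g /= reprK; apply; split=> /=.
    exact: nbhs_singleton.
  exact: eB.
by move=> -[x t] /= [Ux Jt]; apply: W'W; exact: Ux.
Qed.

(** * Realization of simplicial sets of tuples *)

Section SSetRealizationMaps.
Variables (R : realType) (X : sSet).

Lemma sset_pi_eqP (a b : sset_cells R X) :
  \pi_(sset_realization R X) a = \pi_(sset_realization R X) b <->
  Relation_Operators.clos_refl_sym_trans _ (@sset_glue R X) a b.
Proof.
have e : reflect (a = b %[mod_eq sset_equiv R X]) (sset_rel a b) by exact: eqmodP.
by split=> [|ab]; [move=> /e/asboolP|apply/e/asboolP].
Qed.

(** Maps out of the realization are defined by evaluation at [repr], and are computed here on the
    class of a cell: invariance under generating pairs passes to the equivalence closure. *)
Lemma sset_repr_glue (Z : Type) (f : sset_cells R X -> Z) :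
  (forall a b, sset_glue a b -> f a = f b) ->
  forall a, f (repr (\pi_(sset_realization R X) a)) = f a.
Proof.
move=> f_glue a.
have f_clos b c : Relation_Operators.clos_refl_sym_trans _ (@sset_glue R X) b c ->
    f b = f c.
  by elim=> [? ? /f_glue|?|? ? _ ->|? ? ? _ -> _ ->].
by apply/f_clos/sset_pi_eqP; exact: reprK.
Qed.

Lemma sset_point_continuous n (x : simplices X n) :
  continuous (@sset_point R X n x).
Proof. by move=> t; exact: existT_continuous. Qed.

Lemma sset_cells_continuous (Z : topologicalType) (f : sset_cells R X -> Z) :
  (forall n (x : simplices X n), continuous (fun t => f (sset_point x t))) ->
  continuous f.
Proof. by move=> fc [[n x] t]; exact: fc. Qed.

End SSetRealizationMaps.

Section TupleRealization.
Variables (R : realType) (T : Type) (P : forall n, set ('I_n.+1 -> T)).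
Arguments P : clear implicits.
Hypothesis P_closed : forall m n (f : delta_hom m n) (x : 'I_n.+1 -> T),
  P n x -> P m (x \o f).

Local Notation X := (tuple_sset P_closed).

(** Membership proofs are separate arguments, so that [tuple_point_eq] can replace the weights by
    equal ones using proof irrelevance. *)
Definition tuple_cell n (x : 'I_n.+1 -> T) (Px : P n x)
    (t : {ptws 'I_n.+1 -> R}) (St : std_simplex R n t) : sset_cells R X :=
  @sset_point R X n (exist _ x (mem_set Px)) (exist _ t (mem_set St)).

Definition tuple_point n (x : 'I_n.+1 -> T) (Px : P n x)
    (t : {ptws 'I_n.+1 -> R}) (St : std_simplex R n t) : sset_realization R X :=
  \pi_(sset_realization R X) (tuple_cell Px St).

Lemma tuple_point_eq n (x : 'I_n.+1 -> T) (Px Px' : P n x) t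
    (St : std_simplex R n t) t' (St' : std_simplex R n t') :
  t = t' -> tuple_point Px St = tuple_point Px' St'.
Proof.
by move=> tt'; subst t'; rewrite (Prop_irrelevance Px Px') (Prop_irrelevance St St').
Qed.

Lemma tuple_cellP (c : sset_cells R X) :
  exists n x (Px : P n x) t (St : std_simplex R n t), c = tuple_cell Px St.
Proof.
case: c => [[n [x Px]] [t St]].
exists n, x, (set_mem Px), t, (set_mem St); rewrite /tuple_cell.
by congr sset_point; apply: val_inj.
Qed.

Lemma tuple_pointP (q : sset_realization R X) :
  exists n x (Px : P n x) t (St : std_simplex R n t), q = tuple_point Px St.
Proof.
have [n [x [Px [t [St qE]]]]] := tuple_cellP (repr q).
by exists n, x, Px, t, St; rewrite /tuple_point -qE reprK.
Qed.

(** The generating relation, with the reindexed tuple and the pushed weights given only up to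
    provable equality. *)
Lemma tuple_point_glue m n (f : delta_hom m n)
    x (Px : P m x) t (St : std_simplex R m t)
    y (Py : P n y) u (Su : std_simplex R n u) :
  x = y \o f -> u = push f t -> tuple_point Px St = tuple_point Py Su.
Proof.
move=> xE uE; apply/sset_pi_eqP; apply: Relation_Operators.rst_step.
have -> : tuple_cell Px St = sset_point (X := X)
    (fmor X f (exist _ y (mem_set Py))) (exist _ t (mem_set St)).
  by congr sset_point; apply: val_inj.
have -> : tuple_cell Py Su = sset_point (X := X) (exist _ y (mem_set Py))
    (std_simplex_map f (exist _ t (mem_set St))).
  by congr sset_point; apply: val_inj.
by constructor.
Qed.

Lemma sset_glueP (a b : sset_cells R X) : sset_glue a b ->
  exists m n (f : delta_hom m n) x (Px : P n x) (Pxf : P m (x \o f))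
    t (St : std_simplex R m t) (Sft : std_simplex R n (push f t)),
  a = tuple_cell Pxf St /\ b = tuple_cell Px Sft.
Proof.
move=> [m n f [x Px] [t St]].
exists m, n, f, x, (set_mem Px), (P_closed f (set_mem Px)), t, (set_mem St).
exists (push_coords_simplex f (set_mem St)).
by split; congr sset_point; apply: val_inj.
Qed.

End TupleRealization.

(** * Comparison with the realization of a simplicial complex *)

Lemma setI_eq_on (S : Type) (A B C : set S) x :
  A `&` B = A `&` C -> A x -> B x = C x.
Proof.
move=> ABC Ax; apply/propext.
have := congr1 (fun D => D x) ABC; rewrite /setI /mkset => E.
by split=> ?; [have [] : A x /\ C x by rewrite -E|have [] : A x /\ B x by rewrite E].
Qed.

Section BarycentricCoordinates.
Variables (R : realType) (K : scpx).
Local Notation T := {classic K}.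

Lemma push_sc_point n (x : 'I_n.+1 -> T) (t : {ptws 'I_n.+1 -> R}) :
  sc_simplex (range x : set K) -> std_simplex R n t ->
  sc_point (push x t : {ptws T -> R}).
Proof.
move=> Kx [t0 t1]; split; last by rewrite push_sum.
- by move=> v; apply: sumr_ge0.
- apply: (sc_down Kx); first exact (@push_supp R _ T x t).
  (* The support is nonempty, since the weights sum to 1. *)
  apply/set0P/negP => /eqP xt0; have := push_sum x t; rewrite t1 => /esym/eqP.
  rewrite fsbig1 ?oner_eq0// => v _; apply: contrapT => /eqP xtv.
  by have : set0 v by rewrite -xt0.
Qed.

Lemma pull_std_simplex n (y : 'I_n.+1 -> T) (u : sc_points R K) :
  injective y -> [set v | val u v != 0] `<=` range y ->
  std_simplex R n (val u \o y).
Proof.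
move=> y_inj uy; have [u0 _ u1] := set_valP u.
by split=> [i|]; [exact: u0|rewrite -u1; exact: (pull_sum y_inj uy)].
Qed.

End BarycentricCoordinates.

Section Comparison.
Variables (R : realType) (K : scpx).
Local Notation T := {classic K}.
Variable le : rel T.
Hypothesis le_order : total_order le.
Variable P : forall n, set ('I_n.+1 -> K).
Arguments P : clear implicits.
Hypothesis P_closed : forall m n (f : delta_hom m n) (x : 'I_n.+1 -> K),
  P n x -> P m (x \o f).
Hypothesis P_simplex : forall n x, P n x -> sc_simplex (range x).
Hypothesis simplex_P : forall n (x : 'I_n.+1 -> T),
  monotone_tuple le x -> sc_simplex (range x : set K) -> P n x.

Local Notation X := (tuple_sset P_closed).
Local Notation TP := (tuple_point P_closed).

Definition cell_bary (c : sset_cells R X) : sc_points R K :=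
  let: existT s t := c in
  exist _ (push (val (tagged s) : 'I_(tag s).+1 -> T) (val t))
    (mem_set (push_sc_point (P_simplex (set_valP (tagged s))) (set_valP t))).

Definition bary (q : sset_realization R X) : scpx_realization R K :=
  cell_bary (repr q).

Lemma cell_bary_glue a b : sset_glue a b -> cell_bary a = cell_bary b.
Proof.
move=> /sset_glueP[m [n [f [x [Px [Pxf [t [St [Sft [-> ->]]]]]]]]]].
by apply: val_inj; exact: push_comp.
Qed.

Lemma bary_point n (x : 'I_n.+1 -> T) (Px : P n x) t (St : std_simplex R n t) :
  val (bary (TP Px St)) = push x t.
Proof. by rewrite /bary sset_repr_glue//; exact: cell_bary_glue. Qed.

Lemma push_continuous n (x : 'I_n.+1 -> T) :
  continuous (push x : {ptws 'I_n.+1 -> R} -> {ptws T -> R}).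
Proof.
apply: ptws_continuous => v; apply: fun_sum_continuous => i.
exact: ptws_eval_continuous.
Qed.

(** A cell lands in the single closed simplex spanned by its tuple, where a coherent open set is the
    trace of an open set for pointwise convergence; there [push_continuous] applies. *)
Lemma bary_continuous : continuous bary.
Proof.
apply/quotient_continuous; rewrite (_ : _ \o _ = cell_bary); last first.
  by apply/funext => c; apply: sset_repr_glue; exact: cell_bary_glue.
apply: sset_cells_continuous => n [x Px]; apply/continuousP => A oA.
have [W oO AO] := oA _ (P_simplex (set_mem Px)).
have px : continuous (fun t : std_simplex R n =>
    push (x : _ -> T) (val t) : {ptws T -> R}).
  move=> t; apply: continuous_comp; first exact: val_continuous.
  exact: (@push_continuous n x).
rewrite (_ : _ @^-1` A = (fun t => push (x : _ -> T) (val t)) @^-1` W).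
  by move/continuousP : px; apply.
have ux t : closed_simplex (range x)
    (cell_bary (sset_point (exist _ x Px : simplices X n) t)).
  exact (@push_supp R _ T x (val t)).
by apply/funext => t; exact: (setI_eq_on AO (ux t)).
Qed.

Lemma monotone_enum_simplex (s : set K) : sc_simplex s ->
  exists k (y : 'I_k.+1 -> T), [/\ monotone_tuple le y, injective y & range y = s].
Proof.
by move=> Ks; apply: monotone_enum; [|exact: sc_finite|exact: sc_nonempty].
Qed.

(** The point is built on the enumeration z of the support of u. Any enumeration y covering the
    support has z as a face, and u vanishes on the extra vertices, so gluing identifies the two
    points. This freedom in y is what makes [sect] computable on a whole closed simplex. *)
Lemma sect_exists (u : sc_points R K) : exists q : sset_realization R X,
  forall k (y : 'I_k.+1 -> T) (Py : P k y) (Su : std_simplex R k (val u \o y)),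
    monotone_tuple le y -> injective y -> [set v | val u v != 0] `<=` range y ->
    q = TP Py Su.
Proof.
have [_ Ku _] := set_valP u.
have [l [z [z_mono z_inj zE]]] := monotone_enum_simplex Ku.
have uz : [set v | val u v != 0] `<=` range z by rewrite zE.
have Pz : P l z by apply: simplex_P; rewrite ?zE.
exists (TP Pz (pull_std_simplex z_inj uz)) => k y Py Su y_mono y_inj uy.
have [|f fE] := monotone_factor le_order z_mono y_mono y_inj; first by rewrite zE.
apply: (tuple_point_glue P_closed (f := f)) => //; rewrite fE; apply/esym/push_pull.
  by move=> i j fij; apply: z_inj; rewrite fE /= fij.
move=> i uyi; have [j _ zj] : range z (y i) by rewrite zE.
by exists j => //; apply: y_inj; rewrite -zj fE.
Qed.

Definition sect (u : scpx_realization R K) : sset_realization R X :=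
  sval (cid (sect_exists u)).

Lemma sect_point (u : scpx_realization R K) k (y : 'I_k.+1 -> T) (Py : P k y)
    (Su : std_simplex R k (val u \o y)) :
  monotone_tuple le y -> injective y -> [set v | val u v != 0] `<=` range y ->
  sect u = TP Py Su.
Proof. exact: (svalP (cid (sect_exists u))). Qed.

Lemma sectK : cancel sect bary.
Proof.
move=> u; have [_ Ku _] := set_valP u.
have [k [y [y_mono y_inj yE]]] := monotone_enum_simplex Ku.
have uy : [set v | val u v != 0] `<=` range y by rewrite yE.
have Py : P k y by apply: simplex_P; rewrite ?yE.
rewrite (sect_point Py (pull_std_simplex y_inj uy))//.
by apply: val_inj; rewrite bary_point push_pull.
Qed.

(** On the closed simplex of s, one enumeration y of s serves all points: [sect] restricts
    coordinates along y, then applies the quotient map to the cell of y. Both steps are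
    continuous. *)
Lemma sect_continuous : continuous sect.
Proof.
apply/continuousP => A oA.
suff : coherent_open (sect @^-1` A) by [].
move=> s Ks.
have [k [y [y_mono y_inj yE]]] := monotone_enum_simplex Ks.
have Py : P k y by apply: simplex_P; rewrite ?yE.
(* Being open in the subspace [std_simplex R k] means being the trace of an open set W of the
   function space. *)
have [W oO OE] : open [set t : std_simplex R k | A (TP Py (set_valP t))].
  rewrite (_ : mkset _ = (fun t : std_simplex R k => \pi_(sset_realization R X)
      (sset_point (exist _ y (mem_set Py) : simplices X k) t)) @^-1` A).
    apply: open_comp => // t _; apply: continuous_comp; last exact: pi_continuous.
    exact: sset_point_continuous.
  apply/funext => t /=; congr (A (\pi_ _ _)); congr sset_point.
  exact: val_inj.
have {}OE t (St : std_simplex R k t) : A (TP Py St) = W t.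
  pose t' : std_simplex R k := exist _ t (mem_set St).
  rewrite (Prop_irrelevance St (set_valP t')).
  exact: esym (congr1 (@^~ t') OE).
exists [set u : {ptws T -> R} | W (u \o y)].
  have /continuousP : continuous (fun u : {ptws T -> R} =>
      u \o y : {ptws 'I_k.+1 -> R}).
    by apply: ptws_continuous => i; exact: ptws_eval_continuous.
  exact.
have sectE u : closed_simplex s u -> A (sect u) = W (val u \o y).
  move=> us; have uy : [set v | val u v != 0] `<=` range y by rewrite yE.
  have Su := pull_std_simplex y_inj uy.
  by rewrite (sect_point Py Su)// OE.
by apply/seteqP; split=> u [us Au]; split=> //; move: Au;
  rewrite /preimage /mkset sectE.
Qed.

Lemma sect_bary_point n (x : 'I_n.+1 -> T) (Px : P n x) t (St : std_simplex R n t)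
    k (y : 'I_k.+1 -> T) (Py : P k y) (Su : std_simplex R k (push x t \o y)) :
  monotone_tuple le y -> injective y -> range x `<=` range y ->
  sect (bary (TP Px St)) = TP Py Su.
Proof.
move=> y_mono y_inj xy.
have uE := bary_point Px St.
move: (bary _) uE => u uE; move: Su; rewrite -uE => Su; apply: sect_point => //.
by rewrite uE; apply: subset_trans xy; exact: push_supp.
Qed.

(** A monotone tuple x is a degeneracy of the enumeration y of its range, so every point on x is
    glued to the point on y that [sect] returns. *)
Lemma monotone_homeomorphic :
  (forall n (x : 'I_n.+1 -> T), P n x -> monotone_tuple le x) ->
  homeomorphic (scpx_realization R K) (sset_realization R X).
Proof.
move=> P_mono; exists sect, bary; split.
- exact: sect_continuous.
- exact: bary_continuous.
- exact: sectK.
- move=> q; have [n [/= x [Px [t [St ->]]]]] := tuple_pointP q.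
  have [k [y [y_mono y_inj yE]]] := monotone_enum_simplex (P_simplex Px).
  have Py : P k y by apply: simplex_P; rewrite ?yE//; exact: P_simplex.
  have [|f fE] := monotone_factor le_order (P_mono _ _ Px) y_mono y_inj.
    by rewrite yE.
  have ftE : push (x : _ -> T) t \o y = push f t.
    by apply/funext => i; rewrite fE push_comp /= push_injE.
  have Su : std_simplex R k (push (x : _ -> T) t \o y).
    by rewrite ftE; exact: push_coords_simplex.
  rewrite (sect_bary_point Px St Py Su)//; last by rewrite yE.
  by apply/esym/(tuple_point_glue P_closed (f := f)).
Qed.

End Comparison.

(** * The sorting homotopy *)

Section Clamp.
Variable R : realType.

(** Clamping the time makes the sorting homotopy defined and continuous at all real times, not only
    on the unit interval. *)
Definition clamp (s : R) : R := Num.min 1 (Num.max 0 s).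

Lemma clamp_ge0 s : 0 <= clamp s.
Proof. by rewrite /clamp le_min ler01 le_max lexx. Qed.

Lemma clamp_le1 s : clamp s <= 1.
Proof. by rewrite /clamp ge_min lexx. Qed.

Lemma clamp0 : clamp 0 = 0.
Proof. by rewrite /clamp maxxx min_r. Qed.

Lemma clamp1 : clamp 1 = 1.
Proof. by rewrite /clamp max_r// minxx. Qed.

Lemma clamp_continuous : continuous clamp.
Proof.
move=> s; apply: continuous_min; first exact: cvg_cst.
by apply: continuous_max; [exact: cvg_cst|exact: cvg_id].
Qed.

End Clamp.

Section SortingHomotopy.
Variables (R : realType) (K : scpx).
Local Notation T := {classic K}.
Variable le : rel T.
Hypothesis le_order : total_order le.
Variable P : forall n, set ('I_n.+1 -> K).
Arguments P : clear implicits.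
Hypothesis P_closed : forall m n (f : delta_hom m n) (x : 'I_n.+1 -> K),
  P n x -> P m (x \o f).
Hypothesis P_simplex : forall n x, P n x -> sc_simplex (range x).
Hypothesis simplex_P : forall n (x : 'I_n.+1 -> T),
  sc_simplex (range x : set K) -> P n x.

Local Notation X := (tuple_sset P_closed).
Local Notation TP := (tuple_point P_closed).

Lemma push_pull_std_simplex n (x : 'I_n.+1 -> T) t k (y : 'I_k.+1 -> T) :
  injective y -> range x `<=` range y -> std_simplex R n t ->
  std_simplex R k (push x t \o y).
Proof.
move=> y_inj xy [t0 t1]; split=> [i|]; first exact: sumr_ge0.
rewrite -t1 -(push_sum x); apply: (pull_sum y_inj).
by apply: subset_trans xy; exact (@push_supp R _ T x t).
Qed.

Definition mix m n (s : R) (t : 'I_m.+1 -> R) (w : 'I_n.+1 -> R) :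
    {ptws 'I_(m + n.+1).+1 -> R} :=
  tuple_join (fun i => s * t i) (fun i => (1 - s) * w i).

Lemma mix_std_simplex m n (s : R) t w : 0 <= s -> s <= 1 ->
  std_simplex R m t -> std_simplex R n w -> std_simplex R _ (mix s t w).
Proof.
move=> s0 s1 [t0 t1] [w0 w1]; split=> [|].
  elim/join_ind => i; rewrite /mix ?tuple_joinl ?tuple_joinr mulr_ge0//.
  by rewrite subr_ge0.
rewrite big_join; under eq_bigr do rewrite /mix tuple_joinl.
under [X in _ + X]eq_bigr do rewrite /mix tuple_joinr.
by rewrite -!mulr_sumr t1 w1 !mulr1 addrC subrK.
Qed.

Lemma push_mix m n m' n' (f : delta_hom m m') (g : delta_hom n n') s t w :
  push (delta_join f g) (mix s t w) = mix s (push f t) (push g w) :> (_ -> R).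
Proof.
rewrite /mix push_delta_join; congr tuple_join; apply/funext => i.
  by rewrite /push mulr_sumr.
by rewrite /push mulr_sumr.
Qed.

Definition sort_join n (x : 'I_n.+1 -> T) :
    'I_(n + (range_size le_order x).+1).+1 -> T :=
  tuple_join x (range_enum le_order x).

Arguments sort_join [n] x.

(** At time 1 all the weight is on the word x, at time 0 on its sorted copy. *)
Definition sort_mix n (x : 'I_n.+1 -> T) (s : R) (t : 'I_n.+1 -> R) :
    {ptws 'I_(n + (range_size le_order x).+1).+1 -> R} :=
  mix (clamp s) t (push x t \o range_enum le_order x).

Arguments sort_mix [n] x s t.

(** Appending the sorted copy adds no vertex. The resulting word is in general not monotone, hence
    the assumption that [P] contains all simplex tuples. *)
Lemma sort_join_closed n (x : 'I_n.+1 -> T) : P n x -> P _ (sort_join x).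
Proof.
move=> Px; have [_ _ yE] := range_enumP le_order x; apply: simplex_P.
by rewrite range_tuple_join yE setUid; exact: P_simplex.
Qed.

Lemma sort_mix_std_simplex n (x : 'I_n.+1 -> T) s t :
  std_simplex R n t -> std_simplex R _ (sort_mix x s t).
Proof.
have [_ y_inj yE] := range_enumP le_order x => St.
apply: mix_std_simplex; rewrite ?clamp_ge0 ?clamp_le1//.
by apply: push_pull_std_simplex; rewrite ?yE.
Qed.

Definition cell_homotopy (cs : sset_cells R X * R) : sset_realization R X :=
  let: existT s t := cs.1 in
  TP (sort_join_closed (set_valP (tagged s)))
     (sort_mix_std_simplex (val (tagged s) : _ -> T) cs.2 (set_valP t)).

Lemma cell_homotopy_cell n (x : 'I_n.+1 -> T) (Px : P n x) t
    (St : std_simplex R n t) s :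
  cell_homotopy (tuple_cell P_closed Px St, s) =
  TP (sort_join_closed Px) (sort_mix_std_simplex x s St).
Proof. exact: tuple_point_eq. Qed.

(** Reindexing x along f can only remove vertices, so the sorted copy of [x \o f] is that of x
    reindexed along some monotone g. The ordinal sum of f and g then glues the two concatenated
    points. *)
Lemma cell_homotopy_glue a b s :
  sset_glue a b -> cell_homotopy (a, s) = cell_homotopy (b, s).
Proof.
move=> /sset_glueP[m [n [f [/= x [Px [Pxf [t [St [Sft [-> ->]]]]]]]]]].
rewrite !cell_homotopy_cell.
have [y_mono y_inj yE] := range_enumP le_order (x : _ -> T).
have [z_mono z_inj zE] := range_enumP le_order (x \o f : _ -> T).
have [|g gE] := monotone_factor le_order z_mono y_mono y_inj.
  by rewrite yE zE => _ [i _ <-]; exists (f i).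
apply: (tuple_point_glue P_closed (f := delta_join f g)).
  by rewrite /sort_join gE tuple_join_comp.
rewrite /sort_mix push_mix; congr mix; rewrite gE (push_comp (x : _ -> T) f).
set v := push _ _ \o range_enum le_order (x : _ -> T).
(* The weights v live on vertices of [x \o f], that is, on the range of the injective map g, so
   pulling back and pushing forward along g returns v. *)
suff v_pull : push g (v \o g) = v by exact: esym v_pull.
apply: push_pull.
  by move=> i j gij; apply: z_inj; rewrite gE /= gij.
move=> j; rewrite /v /= -(push_comp (x : _ -> T) f) => /push_supp.
rewrite -zE => -[i _ zij].
by exists i => //; apply: y_inj; rewrite -zij gE.
Qed.

Lemma sort_mix_continuous n (x : 'I_n.+1 -> T) :
  continuous (fun p : {ptws 'I_n.+1 -> R} * R => sort_mix x p.2 p.1).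
Proof.
have t_continuous (i : 'I_n.+1) :
    continuous (fun p : {ptws 'I_n.+1 -> R} * R => p.1 i).
  apply: (@fun_comp_continuous _ {ptws 'I_n.+1 -> R} R fst (@^~ i)).
    exact: fst_continuous.
  exact: ptws_eval_continuous.
have s_continuous : continuous (fun p : {ptws 'I_n.+1 -> R} * R => clamp p.2).
  apply: fun_comp_continuous; [exact: snd_continuous|exact: clamp_continuous].
apply: ptws_continuous; elim/join_ind => i.
- rewrite (_ : (fun _ => _) = fun p => clamp p.2 * p.1 i); last first.
    by apply/funext => p; rewrite /sort_mix /mix tuple_joinl.
  exact: fun_mul_continuous.
- rewrite (_ : (fun _ => _) = fun p => (1 - clamp p.2) *
      \sum_(j | x j == range_enum le_order x i) p.1 j); last first.
    by apply/funext => p; rewrite /sort_mix /mix tuple_joinr.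
  apply: fun_mul_continuous; last exact: fun_sum_continuous.
  by apply: fun_sub_continuous => //; exact: cst_continuous.
Qed.

Lemma cell_homotopy_continuous : continuous cell_homotopy.
Proof.
apply: sigT_prod_continuous => -[n [x Px]].
pose h (p : std_simplex R n * R) : std_simplex R _ :=
  exist _ (sort_mix (x : _ -> T) p.2 (val p.1))
    (mem_set (sort_mix_std_simplex x p.2 (set_valP p.1))).
have hc : continuous h.
  apply: set_type_continuous.
  have := fun_comp_continuous (f := fun p : std_simplex R n * R => (val p.1, p.2))
    _ (@sort_mix_continuous n x).
  apply; apply: fun_pair_continuous; last exact: snd_continuous.
  apply: fun_comp_continuous; [exact: fst_continuous|exact: val_continuous].
pose c : simplices X (n + (range_size le_order (x : _ -> T)).+1) :=
  (exist _ (sort_join (x : _ -> T)) (mem_set (sort_join_closed (set_mem Px))) : P _).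
have -> : (fun p : std_simplex R n * R => cell_homotopy
    (sset_point (exist _ x Px : simplices X n) p.1, p.2)) =
    (fun p => \pi_(sset_realization R X) (sset_point c (h p))).
  by apply/funext => p; exact: tuple_point_eq.
apply: fun_comp_continuous; last exact: pi_continuous.
by apply: fun_comp_continuous; [exact: hc|exact: sset_point_continuous].
Qed.

Definition homotopy (p : sset_realization R X * R) : sset_realization R X :=
  cell_homotopy (repr p.1, p.2).

Lemma homotopy_pi c s :
  homotopy (\pi_(sset_realization R X) c, s) = cell_homotopy (c, s).
Proof.
apply: (sset_repr_glue (f := fun c => cell_homotopy (c, s))) => a b.
exact: cell_homotopy_glue.
Qed.

(** The product of the quotient map with R still detects continuity, by
    [quotient_prod_continuous]. *)
Lemma homotopy_continuous : continuous homotopy.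
Proof.
apply: quotient_prod_continuous.
under eq_fun do rewrite homotopy_pi.
rewrite (_ : (fun _ => _) = cell_homotopy); first exact: cell_homotopy_continuous.
by apply/funext => -[].
Qed.

Let simplex_P' n (x : 'I_n.+1 -> T) :
  monotone_tuple le x -> sc_simplex (range x : set K) -> P n x.
Proof. by move=> _; exact: simplex_P. Qed.

(** At time 0 the original word has weight zero, so the point is glued to its sorted block, which is
    where [sect] puts it. *)
Lemma homotopy0 q :
  homotopy (q, 0) = sect le_order P_closed simplex_P' (bary P_simplex q).
Proof.
have [n [/= x [Px [t [St ->]]]]] := tuple_pointP q.
rewrite homotopy_pi cell_homotopy_cell.
have [y_mono y_inj yE] := range_enumP le_order (x : _ -> T).
have Py : P _ (range_enum le_order (x : _ -> T)).
  by apply: simplex_P; rewrite yE; exact: P_simplex.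
have Sw : std_simplex R _ (push (x : _ -> T) t \o range_enum le_order (x : _ -> T)).
  by apply: push_pull_std_simplex; rewrite ?yE.
rewrite (sect_bary_point _ _ _ _ Px St Py Sw)//; last by rewrite yE.
apply/esym/(tuple_point_glue P_closed (f := delta_inr _ _)).
  by apply/funext => i; rewrite /sort_join /= tuple_joinr.
rewrite push_delta_inr /sort_mix /mix clamp0; congr tuple_join; apply/funext => i.
  by rewrite mul0r.
by rewrite subr0 mul1r.
Qed.

Lemma homotopy1 q : homotopy (q, 1) = q.
Proof.
have [n [/= x [Px [t [St ->]]]]] := tuple_pointP q.
rewrite homotopy_pi cell_homotopy_cell.
apply/esym/(tuple_point_glue P_closed (f := delta_inl _ _)).
  by apply/funext => i; rewrite /sort_join /= tuple_joinl.
rewrite push_delta_inl /sort_mix /mix clamp1; congr tuple_join; apply/funext => i.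
  by rewrite mul1r.
by rewrite subrr mul0r.
Qed.

Lemma simplex_tuples_homotopy_equivalent :
  homotopy_equivalent R (scpx_realization R K) (sset_realization R X).
Proof.
exists (sect le_order P_closed simplex_P'), (bary P_simplex); split.
- exact: sect_continuous.
- exact: bary_continuous.
(* [bary] after [sect] is the identity, so the constant homotopy serves. *)
- exists fst; split=> [|x|x]; last by [].
    by apply: continuous_subspaceT; exact: fst_continuous.
  by rewrite /= sectK.
- exists homotopy; split; [|exact: homotopy0|exact: homotopy1].
  by apply: continuous_subspaceT; exact: homotopy_continuous.
Qed.

End SortingHomotopy.

(** * Vietoris-Rips complexes *)

Lemma Nmax_simplices_bij (d : Order.disp_t) (V : frameType d) (X : graph V)
    (r : V) (n : nat) :
  set_bij [set: Nmax V X r n]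
    [set x : 'I_n.+1 -> X |
       forall i j : 'I_n.+1, (i <= j)%N -> dist (x i) (x j) ≼ r] sval.
Proof.
split.
- by move=> x _; exact/Nmax_simplicesP/(set_valP x).
- move=> [x Px] [y Py] _ _ /= xy; subst y.
  by rewrite (Prop_irrelevance Px Py).
- by move=> x /Nmax_simplicesP Px; exists (exist _ x (mem_set Px)).
Qed.

(** * The non-symmetric space X' attached to a total order *)

Section OrderedGraph.
Variables (R : realType) (X : graph (ereal_frame R)) (le : rel {classic X}).
Hypothesis le_order : total_order le.

(** The lattice order is the reverse of the usual one, so [\bot%O] is the distance +oo. *)
Definition ordered_dist (a b : X) : ereal_frame R :=
  if le a b then dist a b else \bot%O.

Lemma ordered_dist_refl a : ordered_dist a a = \top%O.
Proof. by have [[[le_refl _] _] _] := le_order; rewrite /ordered_dist le_refl dist_refl. Qed.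

Definition ordered_graph : graph (ereal_frame R) := Graph ordered_dist_refl.

Lemma ereal_val_bot : ereal_val (\bot%O : ereal_frame R) = +oo%E.
Proof. by []. Qed.

Lemma ereal_val_ge0 (r : ereal_frame R) : (0 <= ereal_val r)%E.
Proof. exact: (valP (r : nnereal R)). Qed.

Lemma ereal_val_ninfty (r : ereal_frame R) : ereal_val r != -oo%E.
Proof. by rewrite gt_eqF// (lt_le_trans _ (ereal_val_ge0 r))// ltNyr. Qed.

Lemma ordered_graph_l1 : l1_metric X -> l1_metric ordered_graph.
Proof.
have [[[_ le_trans] _] _] := le_order.
move=> X_l1 a b c; rewrite /= /ordered_dist.
(* If a step goes against the order, the right-hand side is +oo; since +oo plus -oo is -oo in
   [\bar R], the other summand must be known to differ from -oo. *)
case: (boolP (le a b)) => [ab|_]; last by rewrite ereal_val_bot addye ?leey ?ereal_val_ninfty.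
case: (boolP (le b c)) => [bc|_]; last by rewrite ereal_val_bot addey ?leey ?ereal_val_ninfty.
by rewrite (le_trans b)//; exact: X_l1.
Qed.

(** Finiteness of r matters: at r = +oo the bound holds for every pair, ordered or not. *)
Lemma ordered_dist_le (r : ereal_frame R) (a b : X) : (ereal_val r < +oo)%E ->
  ordered_dist a b ≼ r -> le a b /\ dist a b ≼ r.
Proof.
rewrite /ordered_dist; case: ifP => // _ r_fin.
by rewrite /leop ereal_leE ereal_val_bot leNgt r_fin.
Qed.

End OrderedGraph.

Section VietorisRipsRealization.
Variables (R : realType) (X : Met R) (r : ereal_frame R).
Local Notation K := (VR_complex X r).

(** Symmetry of X extends the bound from i <= j to all pairs. *)
Lemma VR_simplex_range n (x : 'I_n.+1 -> K) :
  (forall i j : 'I_n.+1, (i <= j)%N -> dist (x i : vertex (sval X)) (x j) ≼ r) ->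
  sc_simplex (range x).
Proof.
have [_ X_sym _] := svalP X; move=> xr; split; first exact: finite_image.
  by exists (x ord0), ord0.
move=> _ _ [i _ <-] [j _ <-]; have [ij|/ltnW ji] := leqP i j; first exact: xr.
by rewrite X_sym; exact: xr.
Qed.

Lemma ordered_graph_homeomorphic (le : rel {classic vertex (sval X)})
    (le_order : total_order le) : (ereal_val r < +oo)%E ->
  homeomorphic (scpx_realization R K)
    (sset_realization R (Nmax _ (ordered_graph le_order) r)).
Proof.
move=> r_fin.
(* For finite r, the simplices over X' are exactly the monotone simplex tuples of the Vietoris-Rips
   complex. *)
have PE n (x : 'I_n.+1 -> K) :
    Nmax_simplices (X := ordered_graph le_order) r x <->
    monotone_tuple (T := {classic vertex (sval X)}) le x /\ sc_simplex (range x).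
  split=> [/Nmax_simplicesP xr|[x_mono Kx]].
    have {}xr i j ij := ordered_dist_le r_fin (xr i j ij).
    split=> [i j /xr[]//|].
    by apply: VR_simplex_range => i j /xr[].
  have [_ _ xr] := Kx; apply/Nmax_simplicesP => i j ij /=.
  by rewrite /ordered_dist x_mono//; apply: xr; [exists i|exists j].
refine (@monotone_homeomorphic R K le le_order _
  (@Nmax_reindex _ _ (ordered_graph le_order) r) _ _ _).
- by move=> n x /PE[].
- by move=> n x x_mono Kx; apply/PE.
- by move=> n x /PE[].
Qed.

Lemma Sing_VR_homotopy_equivalent :
  homotopy_equivalent R (scpx_realization R K) (sset_realization R (Sing K)).
Proof.
have [le le_order] := total_order_exists {classic K}.
by refine (@simplex_tuples_homotopy_equivalent R K le le_order _
  (@Sing_reindex K) _ _).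
Qed.

End VietorisRipsRealization.

(** * Equality of the two functors *)

Section NmaxSingVR.
Variable R : realType.
Local Notation RR := (ereal_frame R).
Local Notation vtx := (fun X : Met R => vertex (sval X)).

(* Both functors have this form; the functoriality proofs are arguments so that
   they are instances of it up to conversion, and only the families of tuples
   remain to be compared. *)
Definition tuple_functor
  (P : forall (X : Met R) (r : RR) n, set ('I_n.+1 -> vtx X))
  (P_reindex : forall X r m n (f : delta_hom m n) (x : 'I_n.+1 -> vtx X),
    P X r n x -> P X r m (x \o f))
  (P_mono : forall X (r s : RR), r ≼ s -> forall n (x : 'I_n.+1 -> vtx X),
    P X r n x -> P X s n (id \o x))
  (P_map : forall X Y (g : @cathom (Met R) X Y) (r : RR) n (x : 'I_n.+1 -> vtx X),
    P X r n x -> P Y r n (graph_fun g \o x))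
  (S := fun X r => tuple_sset (@P_reindex X r))
  (incl := fun X (r s : RR) (rs : r ≼ s) =>
     tuple_sset_map (@P_reindex X r) (@P_reindex X s) (@P_mono X r s rs))
  (incl1 : forall X (r : RR),
    incl X r r (@catid (opcat (poset_cat RR)) r) = catid (S X r))
  (inclM : forall X (r s t : RR) (st : @cathom (opcat (poset_cat RR)) s t)
    (rs : @cathom (opcat (poset_cat RR)) r s),
    incl X r t (Defs.catcomp st rs) = Defs.catcomp (incl X s t st) (incl X r s rs))
  (obj := fun X => @Functor (opcat (poset_cat RR)) sSet (S X) (incl X)
     (incl1 X) (inclM X))
  (maps := fun X Y (g : @cathom (Met R) X Y) (r : opcat (poset_cat RR)) =>
     tuple_sset_map (@P_reindex X r) (@P_reindex Y r) (@P_map X Y g r))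
  (maps_nat : forall X Y (g : @cathom (Met R) X Y)
     (r s : opcat (poset_cat RR)) (rs : cathom r s),
     Defs.catcomp (maps X Y g s) (fmor (obj X) rs) =
     Defs.catcomp (fmor (obj Y) rs) (maps X Y g r))
  (nat := fun X Y (g : @cathom (Met R) X Y) =>
     @NatTrans (opcat (poset_cat RR)) sSet (obj X) (obj Y) (maps X Y g)
       (maps_nat X Y g))
  (nat1 : forall X, nat X X (catid X) = @catid (sPSh RR) (obj X))
  (natM : forall X Y Z (g : @cathom (Met R) Y Z) (f : @cathom (Met R) X Y),
     nat X Z (Defs.catcomp g f) = @Defs.catcomp (sPSh RR) _ _ _ (nat Y Z g) (nat X Y f)) :
  functor (Met R) (sPSh RR) :=
  @Functor (Met R) (sPSh RR) obj nat nat1 natM.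

(** Apart from the families of tuples all arguments are proofs. They are identified in order, as
    each substitution makes the types of the next pair agree. *)
Lemma tuple_functor_eq P Q a b c d e f g h a' b' c' d' e' f' g' h' : P = Q ->
  @tuple_functor P a b c d e f g h = @tuple_functor Q a' b' c' d' e' f' g' h'.
Proof.
move=> PQ; subst Q.
have ? := Prop_irrelevance a a'; subst a'.
have ? := Prop_irrelevance b b'; subst b'.
have ? := Prop_irrelevance c c'; subst c'.
have ? := Prop_irrelevance d d'; subst d'.
have ? := Prop_irrelevance e e'; subst e'.
have ? := Prop_irrelevance f f'; subst f'.
have ? := Prop_irrelevance g g'; subst g'.
by have ? := Prop_irrelevance h h'; subst h'.
Qed.

Let F := functor_comp (Nmax RR) (Met_incl R).

Let G := functor_comp (postcomp _ Sing) (VR R).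

Definition Nmax_tuple_functor := @tuple_functor
  (fun X r n => @Nmax_simplices _ RR (sval X) r n)
  (fun X r => @Nmax_reindex _ RR (sval X) r)
  (fun X r s rs n x => @Nmax_mono _ RR (sval X) r s n x rs)
  (fun X Y g => @Nmax_vertexwise _ RR (sval X) (sval Y) g)
  (fun X => fmor1 (Nmax_obj (sval X)))
  (fun X => @fmorM _ _ (Nmax_obj (sval X)))
  (fun X Y g => @naturality _ _ _ _ (fmor F g))
  (@fmor1 _ _ F) (@fmorM _ _ F).

Definition SingVR_tuple_functor := @tuple_functor
  (fun X r n => @Sing_simplices (VR_complex X r) n)
  (fun X r => @Sing_reindex (VR_complex X r))
  (fun X r s rs => @Sing_vertexwise _ _ (VR_incl X rs))
  (fun X Y g r => @Sing_vertexwise _ _ (VR_map g r))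
  (fun X => fmor1 (functor_comp Sing (VR_obj X)))
  (fun X => @fmorM _ _ (functor_comp Sing (VR_obj X)))
  (fun X Y g => @naturality _ _ _ _ (fmor G g))
  (@fmor1 _ _ G) (@fmorM _ _ G).

Lemma Nmax_tuple_functorE :
  functor_comp (Nmax RR) (Met_incl R) = Nmax_tuple_functor.
Proof. by []. Qed.

Lemma SingVR_tuple_functorE :
  functor_comp (postcomp _ Sing) (VR R) = SingVR_tuple_functor.
Proof.
(* Convertible, but unification diverges by first comparing the arguments of
   [fobj]; the conversion check is left to the kernel. *)
exact_no_check (erefl (functor_comp (postcomp _ Sing) (VR R))).
Qed.

Lemma Nmax_SingVR :
  functor_comp (Nmax RR) (Met_incl R) = functor_comp (postcomp _ Sing) (VR R).
Proof.
rewrite Nmax_tuple_functorE SingVR_tuple_functorE; apply: tuple_functor_eq.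
apply: functional_extensionality_dep => X.
apply: functional_extensionality_dep => r.
apply: functional_extensionality_dep => n.
apply/funext => x; apply/propext; split.
  by move=> /Nmax_simplicesP xr; exact: VR_simplex_range.
move=> [_ _ xr]; apply/Nmax_simplicesP => i j _.
by apply: xr; [exists i|exists j].
Qed.

End NmaxSingVR.

Theorem theorem18 :
  (forall (d : Order.disp_t) (V : frameType d) (X : graph V) (r : V) (n : nat),
     set_bij [set: Nmax V X r n]
       [set x : 'I_n.+1 -> X |
          forall i j : 'I_n.+1, (i <= j)%N -> dist (x i) (x j) ≼ r]
       sval)
  /\
  (forall R : realType,
     (exists X' : Met R -> graph (ereal_frame R), forall X : Met R,
        l1_metric (X' X) /\
        forall r : ereal_frame R, (ereal_val r < +oo)%E ->
          homeomorphic (scpx_realization R (VR R X r))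
                       (sset_realization R (Nmax _ (X' X) r)))
     /\
     functor_comp (Nmax (ereal_frame R)) (Met_incl R)
       = functor_comp (postcomp _ Sing) (VR R)
     /\
     (forall (X : Met R) (r : ereal_frame R),
        homotopy_equivalent R
          (scpx_realization R (VR R X r))
          (sset_realization R (postcomp _ Sing (VR R X) r)))).
Proof.
split; first exact: Nmax_simplices_bij.
move=> R; split; last by split; [exact: Nmax_SingVR|exact: Sing_VR_homotopy_equivalent].
(* A total order is chosen for each space separately, with no compatibility along morphisms; hence
   the assignment is only one of objects. *)
pose le_order (X : Met R) :=
  svalP (cid (total_order_exists {classic vertex (sval X)})).
exists (fun X => ordered_graph (le_order X)) => X; split.
  by apply: ordered_graph_l1; have [] := svalP X.
by move=> r r_fin; exact: ordered_graph_homeomorphic.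
Qed.
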